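(* Let $X=(X,d,\mu)$ be a class A space and let $\xi$ be a filter on $X$ finer than the Fréchet filter. For $T\in\mathscr{E}(X)$ the following are equivalent: (i) $T\in\mathscr{J}_{\mathrm{co}(\xi)}(X)$; (ii) $\lim_{x\to\xi}\|T\mathbf{1}_{B_x(r)}\|=0$ for all $r>0$; (iii) $\lim_{x\to\xi}\|\mathbf{1}_{B_x(r)}T\|=0$ for all $r>0$.
   Context: Let $(X,d)$ be a non-compact proper metric space (closed balls $B_x(r)=\{y:d(x,y)\le r\}$ compact) and $\mu$ a Radon measure on $X$ with support $X$, with $\mu(B_x(r))>0$ and $\sup_x\mu(B_x(r))<\infty$ for all $r>0$. $L^2(X)=L^2(X,\mu)$; $\mathbf{1}_A$ is multiplication by the characteristic function of a measurable $A$. A kernel $k$ on $X\times X$ is controlled if $k(x,y)=0$ whenever $d(x,y)>r$ for some $r$. $\mathscr{E}(X)$ is the norm closure of the operators $(Op(k)f)(x)=\int k(x,y)f(y)d\mu(y)$ with $k$ bounded, uniformly continuous and controlled. Property A: for every $\varepsilon,r>0$ there is a Borel map $\phi:X\to L^2(X)$ with $\|\phi(x)\|=1$, $\mathrm{supp}\,\phi(x)\subset B_x(s)$ for some $s$ independent of $x$, and $\|\phi(x)-\phi(y)\|<\varepsilon$ if $d(x,y)<r$. A class A space is such an $(X,d,\mu)$ which moreover satisfies $\inf_x\mu(B_x(1/2))>0$ and has Property A. Filters: the Fréchet filter consists of the sets with relatively compact complement. $\lim_{x\to\xi}f(x)=0$ means $\{x:|f(x)|<\varepsilon\}\in\xi$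 for each $\varepsilon>0$. For $F\subset X$, $F^{(r)}=\{x:\inf_{y\notin F}d(x,y)>r\}$; $\mathrm{co}(\xi)=\{F\subset X:F^{(r)}\in\xi\ \forall r>0\}$ (the largest filter $\eta\subset\xi$ such that $F\in\eta\Rightarrow F^{(r)}\in\eta$ for all $r>0$). For such a filter $\eta$, $\mathscr{J}_\eta(X)=\{T\in\mathscr{E}(X):\inf_F\|\mathbf{1}_FT\|=0\}$, infimum over measurable $F\in\eta$. *)

(* Defs.v *)
From HB Require Import structures.
From mathcomp Require Import all_boot all_order all_algebra.
From mathcomp Require Import all_classical all_reals all_analysis.
From mathcomp Require Import complex.

Set Implicit Arguments.
Unset Strict Implicit.
Unset Printing Implicit Defensive.

Import Order.TTheory GRing.Theory Num.Theory.
Local Open Scope classical_set_scope.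
Local Open Scope ring_scope.

Definition cabs (R : realType) (z : R[i]) : R :=
  Num.sqrt (complex.Re z ^+ 2 + complex.Im z ^+ 2).

Definition is_metric (X : Type) (R : realType) (d : X -> X -> R) : Prop :=
  [/\ forall x y, 0 <= d x y,
      forall x y, d x y = 0 <-> x = y,
      forall x y, d x y = d y x
    & forall x y z, d x z <= d x y + d y z].

Definition cball (X : Type) (R : realType) (d : X -> X -> R) (x : X) (r : R)
  : set X := [set y | d x y <= r].

Definition dopen (X : Type) (R : realType) (d : X -> X -> R) (A : set X) : Prop :=
  forall x, A x -> exists2 e : R, 0 < e & [set y | d x y < e] `<=` A.

Definition dcompact (X : Type) (R : realType) (d : X -> X -> R) (K : set X) : Prop :=
  forall (I : Type) (U : I -> set X), (forall i, dopen d (U i)) ->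
    K `<=` \bigcup_i U i ->
    exists J : set I, finite_set J /\ K `<=` \bigcup_(i in J) U i.

Definition dclosure (X : Type) (R : realType) (d : X -> X -> R) (A : set X) : set X :=
  [set x | forall e : R, 0 < e -> exists y, A y /\ d x y < e].

Definition rel_compact (X : Type) (R : realType) (d : X -> X -> R) (A : set X) : Prop :=
  dcompact d (dclosure d A).

(* F^(r) = {x : inf_{y notin F} d(x,y) > r}  (inf over the empty set = +oo) *)
Definition Finner (X : Type) (R : realType) (d : X -> X -> R) (F : set X) (r : R)
  : set X :=
  [set x | (r%:E < ereal_inf [set (d x y)%:E | y in ~` F])%E].

Definition cofilt (X : Type) (R : realType) (d : X -> X -> R) (xi : set_system X)
  : set_system X :=
  [set F | forall r : R, 0 < r -> xi (Finner d F r)].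

Definition finer_than_frechet (X : Type) (R : realType) (d : X -> X -> R)
  (xi : set_system X) : Prop :=
  forall F : set X, rel_compact d (~` F) -> xi F.

Definition lim0 (X : Type) (R : realType) (xi : set_system X) (g : X -> \bar R)
  : Prop :=
  forall e : R, 0 < e -> xi [set x | (`|g x| < e%:E)%E].

Section L2.
Context (dX : measure_display) (X : measurableType dX) (R : realType).
Variable mu : {measure set X -> \bar R}.

Definition cmeas (f : X -> R[i]) : Prop :=
  measurable_fun setT (fun x => complex.Re (f x)) /\
  measurable_fun setT (fun x => complex.Im (f x)).

Definition norm2 (f : X -> R[i]) : \bar R :=
  Lnorm mu 2%:E (fun x => (cabs (f x))%:E).

Definition inL2 (f : X -> R[i]) : Prop := cmeas f /\ (norm2 f < +oo)%E.

(* operators are maps on (representatives of) functions *)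
Definition opnorm (T : (X -> R[i]) -> (X -> R[i])) : \bar R :=
  ereal_sup [set norm2 (T f) | f in [set f | inL2 f /\ (norm2 f <= 1)%E]].

Definition bounded_op (T : (X -> R[i]) -> (X -> R[i])) : Prop :=
  [/\ forall f, inL2 f -> inL2 (T f),
      forall f g, inL2 f -> inL2 g -> {ae mu, forall x, f x = g x} ->
        {ae mu, forall x, T f x = T g x},
      forall (a : R[i]) f g, inL2 f -> inL2 g ->
        {ae mu, forall x, T (fun y => a * f y + g y) x = a * T f x + T g x}
    & (opnorm T < +oo)%E].

Definition mulind (A : set X) (f : X -> R[i]) : X -> R[i] :=
  fun x => if `[< A x >] then f x else 0.

Definition cint (g : X -> R[i]) : R[i] :=
  Complex (Rintegral mu setT (fun y => complex.Re (g y)))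
          (Rintegral mu setT (fun y => complex.Im (g y))).

Definition Op (k : X -> X -> R[i]) (f : X -> R[i]) : X -> R[i] :=
  fun x => cint (fun y => k x y * f y).

Variable d : X -> X -> R.

Definition good_kernel (k : X -> X -> R[i]) : Prop :=
  [/\ exists M : R, forall x y, cabs (k x y) <= M,
      forall e : R, 0 < e -> exists2 delta : R, 0 < delta &
        forall x y x' y', d x x' < delta -> d y y' < delta ->
          cabs (k x y - k x' y') < e
    & exists r : R, forall x y, r < d x y -> k x y = 0].

Definition in_Eop (T : (X -> R[i]) -> (X -> R[i])) : Prop :=
  bounded_op T /\
  forall e : R, 0 < e -> exists k, good_kernel k /\
    (opnorm (fun f x => (T f x - Op k f x)%R) < e%:E)%E.

Definition in_Jop (eta : set_system X) (T : (X -> R[i]) -> (X -> R[i])) : Prop :=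
  in_Eop T /\
  ereal_inf [set opnorm (fun f => mulind F (T f)) |
             F in [set F | measurable F /\ eta F]] = 0%E.

(* open subsets of L^2 (norm topology; U is a set of representatives) *)
Definition L2open (U : set (X -> R[i])) : Prop :=
  forall f, U f -> inL2 f -> exists2 rho : R, 0 < rho &
    forall g, inL2 g -> (norm2 (fun z => (g z - f z)%R) < rho%:E)%E -> U g.

Definition borel_map (phi : X -> X -> R[i]) : Prop :=
  forall U, L2open U -> measurable [set x | U (phi x)].

Definition propertyA : Prop :=
  forall eps r : R, 0 < eps -> 0 < r ->
    exists phi : X -> X -> R[i],
      [/\ borel_map phi,
          forall x, inL2 (phi x) /\ norm2 (phi x) = 1%E,
          exists s : R, forall x y, s < d x y -> phi x y = 0
        & forall x y, d x y < r ->
            (norm2 (fun z => (phi x z - phi y z)%R) < eps%:E)%E].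

Definition radon : Prop :=
  [/\ forall x, exists U, [/\ dopen d U, U x & (mu U < +oo)%E],
      forall A, measurable A ->
        mu A = ereal_inf [set mu U | U in [set U | dopen d U /\ A `<=` U]]
    & forall U, dopen d U ->
        mu U = ereal_sup [set mu K | K in [set K | dcompact d K /\ K `<=` U]]].

Definition classA : Prop :=
  [/\ is_metric d,
      forall x r, dcompact d (cball d x r),
      ~ dcompact d setT,
      (@measurable _ X) = <<s [set A | dopen d A] >>
    & radon] /\
  [/\
      forall U, dopen d U -> U !=set0 -> (0 < mu U)%E,
      forall r : R, 0 < r ->
        (forall x, (0 < mu (cball d x r))%E) /\
        (ereal_sup [set mu (cball d x r) | x in setT] < +oo)%E,
      (0 < ereal_inf [set mu (cball d x 2^-1) | x in setT])%E
    & propertyA].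

End L2.

(* Main.v *)
Require Import Defs.
From HB Require Import structures.
From mathcomp Require Import all_boot all_order all_algebra.
From mathcomp Require Import all_classical all_reals all_analysis.
From mathcomp Require Import complex.
From mathcomp Require Import measurable_realfun ring lra.

Set Implicit Arguments.
Unset Strict Implicit.
Unset Printing Implicit Defensive.

Import Order.TTheory GRing.Theory Num.Theory.
Local Open Scope classical_set_scope.
Local Open Scope ring_scope.

(** If [||1_F T||] is small and [x] lies in [F^(r)], then [B_x(r)] is contained in
    [F], so [||1_{B_x(r)} T||] is small: (i) implies (iii).  Approximating [T] in norm
    by an operator [S] with kernel of range [R], the identity
    [S 1_{B_x(r)} = 1_{B_x(r+R)} S 1_{B_x(r)}] gives (iii) => (ii).  For (ii) => (i),
    property A yields functions [psi_j] with [sum_j psi_j^2 = 1], supported in sets of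
    diameter at most [s], and of small variation at distance [R] in the sense that
    [sum_j |psi_j x - psi_j y|^2] is small.  Then [sum_j ||[psi_j, S] f||^2] is small
    by Cauchy-Schwarz, hence [||1_F S f||^2 = sum_j ||psi_j 1_F S f||^2] is controlled
    by [sum_j ||S psi_j f||^2], the sum being over those [j] for which [psi_j] does not
    vanish on [F]; there [psi_j f] lives in a ball of radius [s] around a point of [F].
    The set [F] of points [x] where [||T 1_{B_x(s)}||] is small, slightly modified to be
    open, belongs to [co(xi)], because moving [x] by [r] only changes the radius.
    All estimates are made on squared norms, up to numerical constants. *)

(** * Squared norms *)

Section Complex.
Context {R : realType}.
Implicit Types z w : R[i].

(** A polynomial in the two parts, so that inequalities between squared moduli reduce to real
    arithmetic. *)
Definition nsq z : R := complex.Re z ^+ 2 + complex.Im z ^+ 2.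

Lemma nsq_ge0 z : 0 <= nsq z.
Proof. by rewrite addr_ge0 ?sqr_ge0. Qed.

Lemma nsq0 : nsq 0 = 0 :> R.
Proof. by rewrite /nsq /= expr0n addr0. Qed.

Lemma sqr_cabs z : cabs z ^+ 2 = nsq z.
Proof. by rewrite /cabs sqr_sqrtr ?nsq_ge0. Qed.

Lemma cabs_ge0 z : 0 <= cabs z.
Proof. exact: sqrtr_ge0. Qed.

Lemma nsqM z w : nsq (z * w) = nsq z * nsq w.
Proof. by case: z w => [a b] [c e]; rewrite /nsq /=; ring. Qed.

Lemma nsqZ (t : R) z : nsq (Complex t 0 * z) = t ^+ 2 * nsq z.
Proof. by rewrite nsqM {1}/nsq /= expr0n addr0. Qed.

Lemma nsqD_le z w : nsq (z + w) <= 2 * nsq z + 2 * nsq w.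
Proof.
case: z w => [a b] [c e]; rewrite /nsq /=.
have := sqr_ge0 (a - c); have := sqr_ge0 (b - e); lra.
Qed.

Lemma nsqB_le z w : nsq (z - w) <= 2 * nsq z + 2 * nsq w.
Proof.
case: z w => [a b] [c e]; rewrite /nsq /=.
have := sqr_ge0 (a + c); have := sqr_ge0 (b + e); lra.
Qed.

Lemma normr_Re_le z : `|complex.Re z| <= cabs z.
Proof. by rewrite -(sqrtr_sqr (complex.Re z)) ler_wsqrtr// lerDl sqr_ge0. Qed.

Lemma normr_Im_le z : `|complex.Im z| <= cabs z.
Proof. by rewrite -(sqrtr_sqr (complex.Im z)) ler_wsqrtr// lerDr sqr_ge0. Qed.

Lemma cabsM z w : cabs (z * w) = cabs z * cabs w.
Proof. by rewrite /cabs -!/(nsq _) nsqM sqrtrM ?nsq_ge0. Qed.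

Lemma ReM_real (t : R) z : complex.Re (Complex t 0 * z) = t * complex.Re z.
Proof. by case: z => a b /=; rewrite mul0r subr0. Qed.

Lemma ImM_real (t : R) z : complex.Im (Complex t 0 * z) = t * complex.Im z.
Proof. by case: z => a b /=; rewrite mul0r addr0. Qed.

End Complex.

Section Energy.
Context {dX : measure_display} {X : measurableType dX} {R : realType}.
Variable mu : {measure set X -> \bar R}.
Implicit Types f g : X -> R[i].

(** The square of the norm, see [norm2E]. Unlike the norm, it is additive over cells and over the
    pieces of a partition of unity. *)
Definition energy f : \bar R := (\int[mu]_x (nsq (f x))%:E)%E.

Lemma energy_ge0 f : (0 <= energy f)%E.
Proof. by apply: integral_ge0 => x _; rewrite lee_fin nsq_ge0. Qed.

Lemma norm2E f : norm2 mu f = (energy f `^ 2^-1)%E.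
Proof.
rewrite /norm2 unlock /energy; congr (_ `^ _)%E; apply: eq_integral => x _.
by rewrite /= ger0_norm ?cabs_ge0// powR_mulrn ?cabs_ge0// sqr_cabs.
Qed.

Lemma norm2_le f (c : R) : 0 <= c ->
  (norm2 mu f <= c%:E)%E = (energy f <= (c ^+ 2)%:E)%E.
Proof.
move=> c0; rewrite norm2E; have := energy_ge0 f.
case: (energy f) => [a| |] //.
  rewrite lee_fin => a0; rewrite poweR_EFin !lee_fin.
  rewrite powR12_sqrt//.
  rewrite -[leRHS](ger0_norm c0) -(sqrtr_sqr c) ler_sqrt ?sqr_ge0//.
by move=> _; rewrite poweRyr ?invr_eq0.
Qed.

Lemma norm2_ge0 f : (0 <= norm2 mu f)%E.
Proof. exact: Lnorm_ge0. Qed.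

Lemma norm2_lty f : (norm2 mu f < +oo)%E = (energy f < +oo)%E.
Proof.
rewrite norm2E; have := energy_ge0 f; case: (energy f) => [a| |] //.
  by rewrite poweR_EFin !ltry.
by move=> _; rewrite poweRyr ?invr_eq0.
Qed.

Lemma opnorm_ge0 U : (0 <= opnorm mu U)%E.
Proof.
have i0 : inL2 mu (fun=> 0 : R[i]).
  split; first by split => /=; exact: measurable_cst.
  by rewrite norm2_lty /energy; under eq_integral do rewrite nsq0; rewrite integral0.
apply: (@le_trans _ _ (norm2 mu (U (fun=> 0)))); first exact: norm2_ge0.
apply: ereal_sup_ubound; exists (fun=> 0) => //; split => //.
by rewrite norm2_le // /energy; under eq_integral do rewrite nsq0; rewrite integral0.
Qed.

Lemma opnorm_leP U (c : R) : 0 <= c -> (opnorm mu U <= c%:E)%E <->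
  (forall f, inL2 mu f -> (energy f <= 1)%E -> (energy (U f) <= (c ^+ 2)%:E)%E).
Proof.
move=> c0; split.
- move=> h f fL f1; rewrite -norm2_le//; apply: le_trans h.
  by apply: ereal_sup_ubound; exists f => //; split => //; rewrite norm2_le// expr1n.
- move=> h; apply: ge_ereal_sup => _ [f [fL f1] <-]; rewrite norm2_le//; apply: h => //.
  by move: f1; rewrite norm2_le// expr1n.
Qed.

Lemma measurable_nsq f : cmeas f -> measurable_fun setT (fun x => nsq (f x)).
Proof. by case=> mr mi; apply: measurable_funD; exact: measurable_funX. Qed.

Lemma le_energy f g : cmeas f -> cmeas g -> (forall x, nsq (f x) <= nsq (g x)) ->
  (energy f <= energy g)%E.
Proof.
move=> mf mg fg; apply: ge0_le_integral => //.
- by move=> x _; rewrite lee_fin nsq_ge0.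
- by apply/measurable_EFinP; exact: measurable_nsq.
- by apply/measurable_EFinP; exact: measurable_nsq.
- by move=> x _; rewrite lee_fin.
Qed.

Lemma cmeasZ (g : X -> R) f : measurable_fun setT g -> cmeas f ->
  cmeas (fun x => Complex (g x) 0 * f x).
Proof.
move=> mg [mr mi]; split.
  by under eq_fun do rewrite ReM_real; exact: measurable_funM.
by under eq_fun do rewrite ImM_real; exact: measurable_funM.
Qed.

Lemma Re_sub (z w : R[i]) : complex.Re (z - w) = complex.Re z - complex.Re w.
Proof. by case: z w => a b [c e]. Qed.
Lemma Im_sub (z w : R[i]) : complex.Im (z - w) = complex.Im z - complex.Im w.
Proof. by case: z w => a b [c e]. Qed.

Lemma cmeasB f g : cmeas f -> cmeas g -> cmeas (fun x => f x - g x).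
Proof.
move=> [fr fi] [gr gi]; split.
  by under eq_fun do rewrite Re_sub; exact: measurable_funB.
by under eq_fun do rewrite Im_sub; exact: measurable_funB.
Qed.

Lemma mulindE (A : set X) f : mulind A f = fun x => Complex (\1_A x) 0 * f x.
Proof.
apply/funext => x; rewrite /mulind indicE.
case: asboolP => Ax; first by rewrite mem_set// mul1r.
by rewrite memNset// mul0r.
Qed.

Lemma cmeas_mulind (A : set X) f : measurable A -> cmeas f -> cmeas (mulind A f).
Proof. by move=> mA mf; rewrite mulindE; apply: cmeasZ. Qed.

Lemma nsq_mulind_le (A : set X) f x : nsq (mulind A f x) <= nsq (f x).
Proof. by rewrite /mulind; case: ifP => // _; rewrite nsq0 nsq_ge0. Qed.

(** A pointwise hypothesis, in place of an identity [h = f + g], lets one estimate serve sums,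
    differences and their truncations to a set. *)
Lemma energyD_le f g h : cmeas f -> cmeas g -> cmeas h ->
  (forall x, nsq (h x) <= 2 * nsq (f x) + 2 * nsq (g x)) ->
  (energy h <= 2%:E * energy f + 2%:E * energy g)%E.
Proof.
move=> mf mg mh hfg.
have mf' := measurable_nsq mf; have mg' := measurable_nsq mg.
rewrite -!ge0_integralZl_EFin//; first last.
- exact/measurable_EFinP.
- by move=> x _; rewrite lee_fin nsq_ge0.
- exact/measurable_EFinP.
- by move=> x _; rewrite lee_fin nsq_ge0.
rewrite -ge0_integralD//; first last.
- by apply/measurable_EFinP; exact: measurable_funM.
- by move=> x _; rewrite lee_fin mulr_ge0// nsq_ge0.
- by apply/measurable_EFinP; exact: measurable_funM.
- by move=> x _; rewrite lee_fin mulr_ge0// nsq_ge0.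
apply: ge0_le_integral => //.
- by move=> x _; rewrite lee_fin nsq_ge0.
- by apply/measurable_EFinP; exact: measurable_nsq.
- by apply/measurable_EFinP; apply: measurable_funD; apply: measurable_funM.
- by move=> x _; rewrite -!EFinM -EFinD lee_fin.
Qed.

Lemma energyZ (t : R) f : cmeas f ->
  energy (fun x => Complex t 0 * f x) = ((t ^+ 2)%:E * energy f)%E.
Proof.
move=> mf; rewrite /energy; under eq_integral do rewrite nsqZ EFinM.
rewrite ge0_integralZl_EFin// ?sqr_ge0//.
  by move=> x _; rewrite lee_fin nsq_ge0.
by apply/measurable_EFinP; exact: measurable_nsq.
Qed.

Lemma inL2P f : inL2 mu f <-> cmeas f /\ (energy f < +oo)%E.
Proof. by rewrite /inL2 norm2_lty. Qed.

Lemma le_inL2 f g : inL2 mu g -> cmeas f -> (forall x, nsq (f x) <= nsq (g x)) -> inL2 mu f.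
Proof.
move=> /inL2P[mg gf] mf fg; apply/inL2P; split=> //.
by apply: le_lt_trans gf; exact: le_energy.
Qed.

Lemma inL2_mulind (A : set X) f : measurable A -> inL2 mu f -> inL2 mu (mulind A f).
Proof.
move=> mA fL; apply: (le_inL2 fL); first by apply: cmeas_mulind => //; case: fL.
by move=> x; exact: nsq_mulind_le.
Qed.

Lemma inL2Z (t : R) f : inL2 mu f -> inL2 mu (fun x => Complex t 0 * f x).
Proof.
move=> /inL2P[mf ff]; apply/inL2P; split; first exact: cmeasZ.
rewrite energyZ//; move: (energy_ge0 f) ff; case: (energy f) => //= a _ _.
by rewrite -EFinM ltry.
Qed.

Lemma ae_eq_energy f g : cmeas f -> cmeas g -> {ae mu, forall x, f x = g x} ->
  energy f = energy g.
Proof.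
move=> mf mg fg; apply: ae_eq_integral => //.
- by apply/measurable_EFinP; exact: measurable_nsq.
- by apply/measurable_EFinP; exact: measurable_nsq.
- by apply: filterS fg => x /= ->.
Qed.

(* Scaling [f] to energy at most one and letting the factor tend to [energy f]
   treats [energy f = 0] without a separate argument. *)
Lemma opnorm_energy (U : (X -> R[i]) -> X -> R[i]) (c : R) :
  0 <= c -> (opnorm mu U <= c%:E)%E ->
  (forall f, inL2 mu f -> cmeas (U f)) ->
  (forall t f, 0 < t -> inL2 mu f ->
     {ae mu, forall x, U (fun y => Complex t 0 * f y) x = Complex t 0 * U f x}) ->
  forall f, inL2 mu f -> (energy (U f) <= (c ^+ 2)%:E * energy f)%E.
Proof.
move=> c0 /(opnorm_leP U c0) Uc mU hU f fL.
have [mf ff] := (inL2P f).1 fL.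
have [a a0 aE] : exists2 a, 0 <= a & energy f = a%:E.
  move: (energy_ge0 f) ff; case: (energy f) => //= a a0 _; exists a => //.
have H b : a < b -> (energy (U f) <= (c ^+ 2 * b)%:E)%E.
  move=> ab; have b0 : 0 < b by exact: le_lt_trans ab.
  have t0 : 0 < Num.sqrt b^-1 by rewrite sqrtr_gt0 invr_gt0.
  have t2 : Num.sqrt b^-1 ^+ 2 = b^-1 by rewrite sqr_sqrtr// invr_ge0 ltW.
  have := Uc _ (inL2Z (Num.sqrt b^-1) fL).
  rewrite energyZ// aE t2 -EFinM lee_fin mulrC ler_pdivrMr// mul1r => /(_ (ltW ab)).
  rewrite (@ae_eq_energy _ (fun x => Complex (Num.sqrt b^-1) 0 * U f x)); first last.
  - exact: hU.
  - by apply: cmeasZ => //; exact: mU.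
  - by apply: mU; exact: inL2Z.
  rewrite energyZ; last exact: mU.
  rewrite t2 lee_pdivrMl// -EFinM mulrC => h; exact: h.
rewrite aE -EFinM.
(* With [b = a + e / (c ^+ 2 + 1)] the excess [c ^+ 2 * (b - a)] is at most [e]; the added 1 keeps
   the denominator positive when [c = 0]. *)
apply/lee_addgt0Pr => e e0; rewrite -EFinD.
have c1 : 0 < c ^+ 2 + 1 by rewrite ltr_wpDl// sqr_ge0.
apply: le_trans (H (a + e / (c ^+ 2 + 1)) _) _; first by rewrite ltrDl divr_gt0.
rewrite lee_fin mulrDr lerD2l mulrA ler_pdivrMr// mulrC ler_pM2l//.
by rewrite lerDl.
Qed.

End Energy.

(** * Integral operators with controlled kernel *)

Section Part.
Context {R : realType}.
Implicit Types z w : R[i].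

(** The boolean index lets one argument treat real and imaginary parts together. *)
Definition part (b : bool) z : R := if b then complex.Re z else complex.Im z.

Lemma nsq_part z : nsq z = part true z ^+ 2 + part false z ^+ 2.
Proof. by []. Qed.

Lemma normr_part_le b z : `|part b z| <= cabs z.
Proof. by case: b; [exact: normr_Re_le|exact: normr_Im_le]. Qed.

Lemma partM_real b (t : R) z : part b (Complex t 0 * z) = t * part b z.
Proof. by case: b; [exact: ReM_real|exact: ImM_real]. Qed.

Lemma partB b z w : part b (z - w) = part b z - part b w.
Proof. by case: b; [exact: Re_sub|exact: Im_sub]. Qed.

Lemma part0 b : part b (0 : R[i]) = 0.
Proof. by case: b. Qed.

Lemma cmeasP (dX : measure_display) (X : measurableType dX) (f : X -> R[i]) :
  cmeas f <-> forall b, measurable_fun setT (fun x => part b (f x)).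
Proof.
split=> [[fr fi] []//|h]; split; [exact: (h true)|exact: (h false)].
Qed.

Lemma cmeasM (dX : measure_display) (X : measurableType dX) (f g : X -> R[i]) :
  cmeas f -> cmeas g -> cmeas (fun x => f x * g x).
Proof.
move=> [fr fi] [gr gi]; split.
  rewrite (_ : (fun x => _) = (fun x => complex.Re (f x) * complex.Re (g x) -
    complex.Im (f x) * complex.Im (g x))); last first.
    by apply/funext => x; case: (f x) (g x) => a b [c e].
  by apply: measurable_funB; exact: measurable_funM.
rewrite (_ : (fun x => _) = (fun x => complex.Re (f x) * complex.Im (g x) +
  complex.Im (f x) * complex.Re (g x))); last first.
  by apply/funext => x; case: (f x) (g x) => a b [c e].
by apply: measurable_funD; exact: measurable_funM.
Qed.

End Part.

(** * Cauchy-Schwarz on a set of finite measure *)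

Section CauchySchwarz.
Context {dX : measure_display} {X : measurableType dX} {R : realType}.
Variable mu : {measure set X -> \bar R}.

(** Cauchy-Schwarz for [w] against the indicator of [B]: AM-GM with a free parameter [t] is
    integrated, then [t] is chosen. The majorant [w] carries both the support condition and the
    square-integral bound. *)
Lemma sqr_Rintegral_le (B : set X) (h w : X -> R) (V W : R) :
  measurable B -> 0 < V -> (mu B <= V%:E)%E ->
  measurable_fun setT h -> measurable_fun setT w ->
  (forall y, `|h y| <= w y) -> (forall y, ~ B y -> w y = 0) ->
  (\int[mu]_y (w y ^+ 2)%:E <= W%:E)%E ->
  (Rintegral mu setT h) ^+ 2 <= V * W.
Proof.
move=> mB V0 BV mh mw hw wB wW.
have w0 y : 0 <= w y by exact: le_trans (hw y).
have W0 : 0 <= W.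
  by rewrite -lee_fin; apply: le_trans wW; apply: integral_ge0 => y _; rewrite lee_fin sqr_ge0.
set I : R := `|Rintegral mu setT h|.
have I0 : 0 <= I by exact: normr_ge0.
(* AM-GM: [2 w <= t 1_B + w^2 / t] *)
have key (t : R) : 0 < t -> 2 * I <= t * V + t^-1 * W.
  move=> t0; have t'0 : 0 < t^-1 by rewrite invr_gt0.
  have H : (2%:E * `|\int[mu]_y (h y)%:E| <= (t * V + t^-1 * W)%:E)%E.
    apply: (@le_trans _ _ (2%:E * \int[mu]_y (w y)%:E)%E).
      rewrite lee_pmul2l//; apply: le_trans (le_abse_integral _ _ _) _ => //.
        exact/measurable_EFinP.
      apply: ge0_le_integral => //.
      - by apply/measurable_EFinP; exact: measurableT_comp.
      - exact/measurable_EFinP.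
      - by move=> y _; rewrite /= lee_fin.
    rewrite -ge0_integralZl_EFin//; first last.
    - exact/measurable_EFinP.
    - by move=> y _; rewrite lee_fin.
    apply: (@le_trans _ _ (\int[mu]_y (t%:E * (\1_B y)%:E + t^-1%:E * (w y ^+ 2)%:E))%E).
      apply: ge0_le_integral => //.
      - by move=> y _; rewrite -EFinM lee_fin mulr_ge0.
      - by apply/measurable_EFinP; exact: measurable_funM.
      - apply/measurable_EFinP; apply: measurable_funD; apply: measurable_funM => //.
        exact: measurable_funX.
      - move=> y _; rewrite -!EFinM -EFinD lee_fin indicE.
        have [By|nBy] := pselect (B y).
          rewrite mem_set//= mulr1 -subr_ge0.
          rewrite (_ : _ - _ = t^-1 * (w y - t) ^+ 2); last by field; rewrite gt_eqF.
          by rewrite mulr_ge0 ?sqr_ge0// ltW.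
        by rewrite memNset//= wB// !mulr0 expr0n mulr0 addr0.
    rewrite ge0_integralD//; first last.
    - by apply/measurable_EFinP; apply: measurable_funM => //; exact: measurable_funX.
    - by move=> y _; rewrite -EFinM lee_fin mulr_ge0 ?sqr_ge0// ltW.
    - by apply/measurable_EFinP; exact: measurable_funM.
    - by move=> y _; rewrite -EFinM lee_fin mulr_ge0// ltW.
    rewrite EFinD; apply: leeD.
      rewrite ge0_integralZl_EFin//; last 2 first.
      - exact/measurable_EFinP.
      - exact: ltW.
      by rewrite integral_indic// setIT EFinM lee_pmul2l.
    rewrite ge0_integralZl_EFin//; last 3 first.
    - by move=> y _; rewrite lee_fin sqr_ge0.
    - by apply/measurable_EFinP; exact: measurable_funX.
    - exact: ltW.
    by rewrite EFinM lee_pmul2l.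
  (* An infinite integral of [h] would contradict the finite bound, so nothing is lost in passing to
     the real-valued integral. *)
  move: H; rewrite /I /Rintegral; case: (\int[mu]_y (h y)%:E)%E => [a| |] /=.
  - by rewrite -EFinM lee_fin.
  - by rewrite gt0_muley ?lte_fin.
  - by rewrite gt0_muley ?lte_fin.
rewrite -real_normK ?num_real// -/I.
(* The value [t = I / V] turns [key] into [I <= V / I * W] without a square root; it is positive
   only when [I] is, hence the case split. *)
have [->|In0] := eqVneq I 0; first by rewrite expr0n mulr_ge0// ltW.
have Ip : 0 < I by rewrite lt_neqAle eq_sym In0.
have := key (I / V) (divr_gt0 Ip V0).
rewrite divfK ?gt_eqF// invf_div => h1.
have h2 : I <= V / I * W by lra.
by move: h2; rewrite mulrAC ler_pdivlMr// -expr2.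
Qed.

End CauchySchwarz.

(** * Borel measurability from the metric *)

Section Metric.
Context {dX : measure_display} {X : measurableType dX} {R : realType}.
Variable d : X -> X -> R.
Hypothesis met : is_metric d.
Hypothesis borel : (@measurable _ X) = <<s [set A | dopen d A] >>.

Let dC x y : d x y = d y x. Proof. by case: met. Qed.
Let dtri x y z : d x z <= d x y + d y z. Proof. by case: met. Qed.

Lemma dopen_measurable A : dopen d A -> measurable A.
Proof. by move=> oA; rewrite borel; apply: sub_sigma_algebra. Qed.

Lemma dopen_oball x r : dopen d [set y | d x y < r].
Proof.
move=> y /= yr; exists (r - d x y); first by rewrite subr_gt0.
by move=> z /= yz; have := dtri x y z; lra.
Qed.

Lemma dopen_bigcup I (D : set I) (U : I -> set X) :
  (forall i, D i -> dopen d (U i)) -> dopen d (\bigcup_(i in D) U i).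
Proof.
move=> oU x [i Di Uix]; have [e e0 he] := oU i Di x Uix.
by exists e => // y /he Uiy; exists i.
Qed.

Lemma measurable_cball x r : measurable (cball d x r).
Proof.
rewrite -[X in measurable X]setCK; apply: measurableC; apply: dopen_measurable.
move=> y /= /negP; rewrite -ltNge => yr; exists (d x y - r); first by rewrite subr_gt0.
by move=> z /= yz; apply/negP; rewrite -ltNge; have := dtri x z y; rewrite (dC z y); lra.
Qed.

Lemma continuous_measurable (g : X -> R) :
  (forall x e, 0 < e -> exists2 t, 0 < t & forall y, d x y < t -> `|g x - g y| < e) ->
  measurable_fun setT g.
Proof.
move=> cg; apply: (measurability (@RGenOInfty.G R)).
  exact: RGenOInfty.measurableE.
move=> _ [_ [a ->] <-]; rewrite setTI; apply: dopen_measurable => x /=.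
rewrite in_itv/= andbT => ax.
have [t t0 ht] := cg x (g x - a) ltac:(by rewrite subr_gt0).
exists t => // y /= /ht; rewrite in_itv/= andbT ltr_norml => /andP[]; lra.
Qed.

End Metric.

(** * Integrability, continuity, support and commutators *)

Section Kernel.
Context {dX : measure_display} {X : measurableType dX} {R : realType}.
Variables (mu : {measure set X -> \bar R}) (d : X -> X -> R).
Hypothesis met : is_metric d.
Hypothesis borel : (@measurable _ X) = <<s [set A | dopen d A] >>.
Hypothesis vol : forall r : R, 0 < r ->
  exists2 V : R, 0 < V & forall x, (mu (cball d x r) <= V%:E)%E.

Variables (k : X -> X -> R[i]) (M r : R).
Hypothesis M0 : 0 <= M.
Hypothesis r0 : 0 < r.
Hypothesis kM : forall x y, cabs (k x y) <= M.
Hypothesis kr : forall x y, r < d x y -> k x y = 0.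
Hypothesis kc : forall e : R, 0 < e -> exists2 delta : R, 0 < delta &
  forall x y x' y', d x x' < delta -> d y y' < delta -> cabs (k x y - k x' y') < e.
Implicit Type f : X -> R[i].

Let dxx x : d x x = 0. Proof. by case: met => _ h _ _; apply/h. Qed.
Let dC x y : d x y = d y x. Proof. by case: met. Qed.
Let dtri x y z : d x z <= d x y + d y z. Proof. by case: met. Qed.
Let mball x s : measurable (cball d x s). Proof. exact: measurable_cball. Qed.

Lemma measurable_cabs f : cmeas f -> measurable_fun setT (fun y => cabs (f y)).
Proof.
move=> mf; rewrite (_ : (fun y => _) = (fun y => nsq (f y) `^ 2^-1)).
  by apply: (measurableT_comp (measurable_powR _)); exact: measurable_nsq.
by apply/funext => y; rewrite powR12_sqrt ?nsq_ge0.
Qed.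

Lemma part_Op b f x :
  part b (Op mu k f x) = Rintegral mu setT (fun y => part b (k x y * f y)).
Proof. by case: b. Qed.

Lemma cmeas_kernel x : cmeas (k x).
Proof.
apply/cmeasP => b; apply: (continuous_measurable borel) => y e e0.
have [t t0 ht] := kc e0; exists t => // y' yy'; rewrite -partB.
by apply: le_lt_trans (normr_part_le _ _) _; apply: ht; rewrite ?dxx.
Qed.

Lemma measurable_kernelM b f x : cmeas f ->
  measurable_fun setT (fun y => part b (k x y * f y)).
Proof. by move=> mf; have /cmeasP := cmeasM (cmeas_kernel x) mf; exact. Qed.

(** The integrand lives on a ball of finite measure, and [|f| <= 1 + |f|^2]; so [M] times the sum of
    the indicator of the ball and [|f|^2] dominates it. *)
Lemma integrable_kernelM b f x : inL2 mu f ->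
  mu.-integrable setT (EFin \o (fun y => part b (k x y * f y))).
Proof.
move=> /inL2P[mf fe]; have [V V0 hV] := vol r0.
apply: (@le_integrable _ _ _ mu setT measurableT _
  (EFin \o (fun y => M * (\1_(cball d x r) y + nsq (f y))))).
- by apply/measurable_EFinP; exact: measurable_kernelM.
- move=> y _; rewrite /= lee_fin [leRHS]ger0_norm; last first.
    by rewrite mulr_ge0// addr_ge0// nsq_ge0.
  apply: le_trans (normr_part_le _ _) _; rewrite indicE.
  have [yr|yr] := pselect (cball d x r y).
    rewrite mem_set// cabsM ler_pM ?cabs_ge0// -sqr_cabs /=.
    by have := sqr_ge0 (cabs (f y) - 2^-1); lra.
  rewrite kr; last by rewrite ltNge; apply/negP.
  by rewrite mul0r /cabs /= expr0n addr0 sqrtr0 mulr_ge0// addr_ge0// nsq_ge0.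
- have mI : measurable_fun setT (fun y => \1_(cball d x r) y + nsq (f y) : R).
    by apply: measurable_funD; [exact: measurable_indic|exact: measurable_nsq].
  apply/integrableP; split.
    by apply/measurable_EFinP; exact: measurable_funM.
  rewrite (@eq_integral _ _ _ _ _ (fun y => M%:E * ((\1_(cball d x r) y)%:E + (nsq (f y))%:E))%E).
    rewrite ge0_integralZl_EFin//; last first.
    - apply: emeasurable_funD; first exact/measurable_EFinP/measurable_indic.
      exact/measurable_EFinP/measurable_nsq.
    - by move=> y _; rewrite -EFinD lee_fin addr_ge0// nsq_ge0.
    rewrite ge0_integralD//; first last.
    - exact/measurable_EFinP/measurable_nsq.
    - by move=> y _; rewrite lee_fin nsq_ge0.
    - exact/measurable_EFinP/measurable_indic.
    rewrite integral_indic// setIT.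
    rewrite lte_mul_pinfty// ?lee_fin//.
    by rewrite lte_add_pinfty//; apply: le_lt_trans (hV x) _; rewrite ltry.
  move=> y _; rewrite /= ger0_norm ?EFinM ?EFinD//.
  by rewrite mulr_ge0// addr_ge0// nsq_ge0.
Qed.

Lemma part_inj (z w : R[i]) : (forall b, part b z = part b w) -> z = w.
Proof.
by case: z w => [a b] [c e] h; congr Complex; [exact: (h true)|exact: (h false)].
Qed.

Lemma OpZ (t : R) f x : inL2 mu f ->
  Op mu k (fun y => Complex t 0 * f y) x = Complex t 0 * Op mu k f x.
Proof.
move=> fL; apply: part_inj => b; rewrite partM_real !part_Op.
under eq_Rintegral do rewrite mulrCA partM_real.
by rewrite RintegralZl//; exact: integrable_kernelM.
Qed.

(** The image is continuous, hence Borel: Cauchy-Schwarz on a ball containing the supports of [k x]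
    and [k x'] bounds its variation by the modulus of continuity of [k]. *)
Lemma cmeas_Op f : inL2 mu f -> cmeas (Op mu k f).
Proof.
move=> fL; have [mf fe] := (inL2P mu f).1 fL.
have [E E0 fE] : exists2 E, 0 <= E & energy mu f = E%:E.
  by move: (energy_ge0 mu f) fe; case: (energy mu f) => //= E E0 _; exists E.
apply/cmeasP => b; apply: (continuous_measurable borel) => x e e0.
have r1 : 0 < r + 1 by rewrite addr_gt0.
have [V V0 hV] := vol r1.
have C1 : 1 <= V * E + 1 by rewrite lerDr mulr_ge0// ltW.
have C0 : 0 < V * E + 1 by exact: lt_le_trans C1.
(* Cauchy-Schwarz will give the squared bound [V * (q ^+ 2 * E)], that is [e ^+ 2] times
   [V * E / (V * E + 1) ^+ 2], which is below [e ^+ 2]. *)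
set q := e / (V * E + 1).
have q0 : 0 < q by rewrite divr_gt0.
have [t t0 ht] := kc q0.
(* Distance below 1 keeps the ball of radius [r] around [x'] inside the ball of radius [r + 1]
   around [x]. *)
exists (Num.min t 1); first by rewrite lt_min t0 ltr01.
move=> x'; rewrite lt_min => /andP[xx't xx'1].
rewrite !part_Op -RintegralB//; try exact: integrable_kernelM.
set D := Rintegral _ _ _.
have DV : D ^+ 2 <= V * (q ^+ 2 * E).
  apply: (@sqr_Rintegral_le _ _ _ mu (cball d x (r + 1)) _
    (fun y => \1_(cball d x (r + 1)) y * q * cabs (f y))) => //.
  - by apply: measurable_funB; exact: measurable_kernelM.
  - apply: measurable_funM; last exact: measurable_cabs.
    by apply: measurable_funM => //; exact: measurable_indic.
  - move=> y; rewrite -partB -mulrBl; apply: le_trans (normr_part_le _ _) _.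
    rewrite indicE cabsM ler_wpM2r ?cabs_ge0//.
    have [yr|yr] := pselect (cball d x (r + 1) y).
      by rewrite mem_set// mul1r ltW// ht// dxx.
    have yr' : r + 1 < d x y by rewrite ltNge; apply/negP.
    rewrite memNset//= mul0r !kr ?subr0 /cabs /= ?expr0n ?addr0 ?sqrtr0//.
      by have := dtri x x' y; lra.
    by lra.
  - by move=> y yB; rewrite indicE memNset// !mul0r.
  - rewrite EFinM -fE -ge0_integralZl_EFin ?sqr_ge0//; last 2 first.
    - by move=> y _; rewrite lee_fin nsq_ge0.
    - exact/measurable_EFinP/measurable_nsq.
    apply: ge0_le_integral => //.
    - by move=> y _; rewrite lee_fin sqr_ge0.
    - apply/measurable_EFinP/measurable_funX; apply: measurable_funM; last exact: measurable_cabs.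
      by apply: measurable_funM => //; exact: measurable_indic.
    - by apply/measurable_EFinP/measurable_funM => //; exact: measurable_nsq.
    - move=> y _; rewrite -EFinM lee_fin !exprMn sqr_cabs.
      rewrite -mulrA ler_piMl//.
      by rewrite mulr_ge0 ?nsq_ge0// mulr_ge0 ?sqr_ge0.
have : D ^+ 2 < e ^+ 2.
  apply: le_lt_trans DV _.
  rewrite (_ : V * _ = e ^+ 2 * (V * E / (V * E + 1) ^+ 2)); last first.
    by rewrite /q; field; rewrite gt_eqF.
  rewrite gtr_pMr ?exprn_gt0// ltr_pdivrMr ?exprn_gt0// mul1r.
  by have := mulr_ge0 (ltW V0) E0; nra.
rewrite -(real_normK (num_real D)) => h.
by rewrite ltNge; apply/negP => eD; move: h; apply/negP; rewrite -leNgt ler_sqr ?nnegrE// ltW.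
Qed.

Lemma Op_support f x s y : (forall z, s < d x z -> f z = 0) ->
  s + r < d x y -> Op mu k f y = 0.
Proof.
move=> fs yr; apply: part_inj => b; rewrite part_Op part0.
under eq_Rintegral => z _.
  rewrite (_ : _ * _ = 0) ?part0; first over.
  have [/fs->|zs] := ltP s (d x z); first by rewrite mulr0.
  by rewrite kr ?mul0r//; have := dtri x z y; rewrite (dC z y); lra.
by rewrite /Rintegral integral0.
Qed.

(** The commutator has kernel [(g x - g y) * k x y]; Cauchy-Schwarz applies to each part, whence the
    factor 2. The ball is centred at a nearby point [c], later a net point, so that it takes only
    countably many values as [x] varies. *)
Lemma nsq_commutator_le (g : X -> R) f x c (V W : R) :
  measurable_fun setT g -> (forall y, `|g y| <= 1) -> inL2 mu f -> d x c <= 1 ->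
  0 < V -> (mu (cball d c (r + 1)) <= V%:E)%E ->
  (\int[mu]_y (\1_(cball d c (r + 1)) y * (g x - g y) ^+ 2 * nsq (f y))%:E <= W%:E)%E ->
  nsq (Complex (g x) 0 * Op mu k f x - Op mu k (fun y => Complex (g y) 0 * f y) x)
    <= 2 * (V * (M ^+ 2 * W)).
Proof.
move=> mg g1 fL xc V0 hV hW; have [mf _] := (inL2P mu f).1 fL.
have gfL : inL2 mu (fun y => Complex (g y) 0 * f y).
  apply: (le_inL2 fL); first exact: cmeasZ.
  move=> y; rewrite nsqZ ler_piMl ?nsq_ge0//.
  by rewrite -real_normK ?num_real// expr_le1.
have msq : measurable_fun setT (fun y => \1_(cball d c (r + 1)) y * (g x - g y) ^+ 2 * nsq (f y)).
  apply: measurable_funM; last exact: measurable_nsq.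
  apply: measurable_funM; first exact: measurable_indic.
  by apply: measurable_funX; exact: measurable_funB.
have msq' : measurable_fun setT (fun y => \1_(cball d c (r + 1)) y * (M * `|g x - g y|) * cabs (f y)).
  apply: measurable_funM; last exact: measurable_cabs.
  apply: measurable_funM; first exact: measurable_indic.
  by apply: measurable_funM => //; apply: measurableT_comp => //; exact: measurable_funB.
suff H b : part b (Complex (g x) 0 * Op mu k f x -
    Op mu k (fun y => Complex (g y) 0 * f y) x) ^+ 2 <= V * (M ^+ 2 * W).
  by rewrite nsq_part; have := H true; have := H false; lra.
rewrite partB partM_real !part_Op -RintegralZl//; last exact: integrable_kernelM.
rewrite -RintegralB//; last 2 first.
- have := integrableZl measurableT (g x) (@integrable_kernelM b f x fL).
  by apply: eq_integrable => // y _ /=; rewrite EFinM.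
- exact: integrable_kernelM.
apply: (@sqr_Rintegral_le _ _ _ mu (cball d c (r + 1)) _
  (fun y => \1_(cball d c (r + 1)) y * (M * `|g x - g y|) * cabs (f y))) => //.
- apply: measurable_funB; last by apply: measurable_kernelM; exact: cmeasZ.
  by apply: measurable_funM => //; exact: measurable_kernelM.
- move=> y; rewrite mulrCA partM_real -mulrBl normrM indicE.
  have [yr|yr] := pselect (cball d c (r + 1) y).
    rewrite mem_set// mul1r mulrAC mulrC ler_wpM2r//.
    apply: le_trans (normr_part_le _ _) _.
    by rewrite cabsM ler_wpM2r ?cabs_ge0.
  have yr' : r + 1 < d c y by rewrite ltNge; apply/negP.
  rewrite memNset// kr; first by rewrite mul0r part0 normr0 mulr0 !mul0r.
  by have := dtri c x y; rewrite (dC c x); lra.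
- by move=> y yB; rewrite indicE memNset// !mul0r.
- rewrite EFinM; apply: le_trans (lee_wpmul2l _ hW); last by rewrite lee_fin sqr_ge0.
  rewrite -ge0_integralZl_EFin ?sqr_ge0//; last 2 first.
  - by move=> y _; rewrite lee_fin mulr_ge0 ?nsq_ge0// mulr_ge0 ?sqr_ge0.
  - exact/measurable_EFinP.
  apply: ge0_le_integral => //.
  - by move=> y _; rewrite lee_fin sqr_ge0.
  - by apply/measurable_EFinP/measurable_funX.
  - by apply/measurable_EFinP/measurable_funM.
  - move=> y _; rewrite -EFinM lee_fin !exprMn sqr_cabs real_normK ?num_real//.
    rewrite indicE; case: (_ \in _); rewrite ?expr1n ?expr0n /= ?mul1r ?mul0r ?mulr0//.
    by rewrite -mulrA.
Qed.

End Kernel.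

(** * Partitions of unity from property A *)

(** Follows from [|sqrt a - sqrt b| <= sqrt a + sqrt b]. It turns bounds on differences of masses
    into bounds on squared differences of their roots. *)
Lemma sqr_sqrtB_le (R : realType) (a b : R) : 0 <= a -> 0 <= b ->
  (Num.sqrt a - Num.sqrt b) ^+ 2 <= `|a - b|.
Proof.
move=> a0 b0; rewrite -{2}(sqr_sqrtr a0) -{2}(sqr_sqrtr b0) subr_sqr normrM.
rewrite -real_normK ?num_real// expr2 ler_wpM2l//.
rewrite [leRHS]ger0_norm ?addr_ge0 ?sqrtr_ge0//.
by apply: le_trans (ler_normB _ _) _; rewrite !ger0_norm ?sqrtr_ge0.
Qed.

(** In each coordinate the gap is a sum of two squares with nonnegative weights. Integrated over
    unit vectors at squared distance [D], the error becomes [D / (2 * t) + 2 * t], small for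
    suitable [t]. *)
Lemma nsq_le_perturb (R : realType) (t : R) (z w : R[i]) : 0 < t ->
  nsq z <= nsq w + ((2 * t)^-1 * nsq (z - w) + t * (nsq z + nsq w)).
Proof.
move=> t0; case: z w => [a b] [c e]; rewrite /nsq /=.
set u := (2 * t)^-1.
have ut : u * (2 * t) = 1 by rewrite mulVf// mulf_neq0 ?gt_eqF.
have u0 : 0 < u by rewrite invr_gt0 mulr_gt0.
have key x y : x ^+ 2 <= y ^+ 2 + (u * (x - y) ^+ 2 + t * (x ^+ 2 + y ^+ 2)).
  rewrite -subr_ge0.
  rewrite (_ : _ - _ = u * ((x - y) - t * (x + y)) ^+ 2 + t / 2 * (x - y) ^+ 2); last first.
    rewrite /u; field; exact: lt0r_neq0.
  by rewrite addr_ge0// mulr_ge0 ?sqr_ge0// ltW// divr_gt0.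
by have := key a c; have := key b e; lra.
Qed.

(** * Countable nets and Borel cells *)

Section Net.
Context {dX : measure_display} {X : measurableType dX} {R : realType}.
Variable d : X -> X -> R.
Hypothesis met : is_metric d.
Hypothesis borel : (@measurable _ X) = <<s [set A | dopen d A] >>.

Let dxx x : d x x = 0. Proof. by case: met => _ h _ _; apply/h. Qed.
Let dC x y : d x y = d y x. Proof. by case: met. Qed.

(** Each closed ball of integer radius around [x0] is compact, so finitely many unit balls cover it;
    the union of these finite sets of centres over all radii is countable. *)
Lemma countable_net (x0 : X) : (forall x r, dcompact d (cball d x r)) ->
  exists c : nat -> X, forall x, exists n, d x (c n) < 1.
Proof.
move=> prop.
have hs N : exists s : seq X, forall x, d x0 x <= N%:R -> exists2 y, y \in s & d x y < 1.
  have [||J [fJ cJ]] := prop x0 N%:R X (fun y => [set z | d y z < 1]).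
  - by move=> y; exact: dopen_oball.
  - by move=> y _; exists y => //=; rewrite dxx.
  have /finite_seqP[s sJ] := fJ.
  exists s => x xN; have [y Jy /= yx] := cJ x xN.
  by exists y; [move: Jy; rewrite sJ|rewrite dC].
have [s hs'] := choice hs.
(* An index codes a pair of a radius and a position in the list for that radius; numbers that code
   no pair are sent to [x0]. *)
exists (fun n => if unpickle n is Some Ni then nth x0 (s Ni.1) Ni.2 else x0) => x.
have [|y ys xy] := hs' (Num.truncn (d x0 x)).+1 x; first by rewrite ltW// truncnS_gt.
exists (pickle ((Num.truncn (d x0 x)).+1, index y (s (Num.truncn (d x0 x)).+1))).
by rewrite pickleK nth_index.
Qed.

(** Choosing the least index of a net point at distance below 1 makes each cell an open ball minus
    finitely many open balls, hence Borel. *)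
Lemma net_partition (x0 : X) : (forall x r, dcompact d (cball d x r)) ->
  exists (c : nat -> X) (p : X -> nat), (forall x, d x (c (p x)) < 1) /\
    forall n, measurable (p @^-1` [set n]).
Proof.
move=> prop; have [c hc] := countable_net x0 prop.
exists c, (fun x => ex_minn (hc x)); split=> [x|n]; first by case: ex_minnP.
have mO m : measurable [set x | d x (c m) < 1].
  rewrite (_ : [set x | _] = [set x | d (c m) x < 1]).
    exact/(dopen_measurable borel)/dopen_oball.
  by apply/seteqP; split=> x /=; rewrite dC.
rewrite (_ : _ @^-1` _ = [set x | d x (c n) < 1] `&`
    \bigcap_(m in [set m | (m < n)%N]) ~` [set x | d x (c m) < 1]).
  by apply: measurableI => //; apply: bigcap_measurableType => m _; exact: measurableC.
apply/seteqP; split=> x /=.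
  case: ex_minnP => m xm mmin <-; split=> // q /= qm /mmin.
  by rewrite leqNgt qm.
move=> [xn h]; case: ex_minnP => m xm mmin.
apply/eqP; rewrite eqn_leq mmin//= leqNgt; apply/negP => mn.
exact: (h m mn).
Qed.

End Net.

Section Partition.
Context {dX : measure_display} {X : measurableType dX} {R : realType}.
Variables (mu : {measure set X -> \bar R}) (p : X -> nat).
Hypothesis mp : forall n, measurable (p @^-1` [set n]).

(** Every preimage is a countable union of cells, so [g] may be arbitrary. *)
Lemma measurable_fun_partition (dY : measure_display) (Y : measurableType dY)
  (g : nat -> Y) : measurable_fun setT (fun x => g (p x)).
Proof.
move=> _ B mB; rewrite setTI (_ : _ @^-1` _ = \bigcup_(n in g @^-1` B) (p @^-1` [set n])).
  exact: bigcup_measurable.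
apply/seteqP; split=> x /=; first by move=> Bx; exists (p x).
by case=> n /= Bn ->.
Qed.

Lemma trivIset_partition : trivIset setT (fun n => p @^-1` [set n]).
Proof. by move=> i j _ _ [x [/= <- <-]]. Qed.

Lemma integral_partition (h : X -> \bar R) : measurable_fun setT h ->
  (forall x, (0 <= h x)%E) ->
  (\int[mu]_x h x = \sum_(n <oo) \int[mu]_(x in p @^-1` [set n]) h x)%E.
Proof.
have cov : \bigcup_n (p @^-1` [set n]) = setT.
  by apply/seteqP; split=> x // _; exists (p x).
by move=> mh h0; rewrite -cov ge0_integral_bigcup ?cov//; exact: trivIset_partition.
Qed.

End Partition.

Section PartitionOfUnity.
Context {dX : measure_display} {X : measurableType dX} {R : realType}.
Variables (mu : {measure set X -> \bar R}) (d : X -> X -> R).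
Hypothesis met : is_metric d.
Variables (c : nat -> X) (p : X -> nat).
Hypothesis cp : forall x, d x (c (p x)) < 1.
Hypothesis mp : forall n, measurable (p @^-1` [set n]).

Let dC x y : d x y = d y x. Proof. by case: met. Qed.
Let dtri x y z : d x z <= d x y + d y z. Proof. by case: met. Qed.

(* The functions [psi j x = || 1_{P_j} phi (c (p x)) ||] replace the map [phi] of
   property A by countably many Borel functions, so that no joint measurability
   of [phi x z] is needed. *)
Lemma partition_of_unity (eta r : R) : propertyA mu d -> 0 < eta -> 0 < r ->
  exists (psi : nat -> X -> R) (s : R),
    [/\ 0 < s, forall j, measurable_fun setT (psi j),
      forall j x, 0 <= psi j x <= 1,
      forall j x y, psi j x != 0 -> psi j y != 0 -> d x y <= s &
      (forall x, \sum_(j <oo) ((psi j x) ^+ 2)%:E = 1)%E /\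
      (forall x y, d x y < r ->
        (\sum_(j <oo) ((psi j x - psi j y) ^+ 2)%:E <= eta%:E)%E)].
Proof.
move=> pA eta0 r0.
(* Passing from two points to the centres of their cells adds less than 2 to their distance, hence
   [r + 2]. *)
have [phi [_ phiL [s0 phis] phiV]] := pA (eta / 2) (r + 2) (divr_gt0 eta0 (ltr0n _ 2)) (addr_gt0 r0 (ltr0n _ 2)).
have mphi x : measurable_fun setT (fun z => (nsq (phi x z))%:E).
  by apply/measurable_EFinP/measurable_nsq; case: (phiL x) => [] [].
have phi1 x : energy mu (phi x) = 1%E.
  have [_] := phiL x; rewrite norm2E => /(congr1 (fun z => poweR z 2)).
  by rewrite -poweRrM mulVf// poweRe1 ?energy_ge0// poweR1r.
(* The mass that the unit vector [phi x] puts on cell [j]; these masses sum to 1. *)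
pose A x j := (\int[mu]_(z in p @^-1` [set j]) (nsq (phi x z))%:E)%E.
have A0 x j : (0 <= A x j)%E by apply: integral_ge0 => z _; rewrite lee_fin nsq_ge0.
have A1 x j : (A x j <= 1)%E.
  rewrite -(phi1 x); apply: ge0_subset_integral => //.
  by move=> z _; rewrite lee_fin nsq_ge0.
have AE x j : (fine (A x j))%:E = A x j.
  by rewrite fineK// ge0_fin_numE//; apply: le_lt_trans (A1 x j) _; rewrite ltry.
have fA0 x j : 0 <= fine (A x j) by rewrite fine_ge0.
have fA1 x j : fine (A x j) <= 1 by rewrite -lee_fin AE.
(* A cell that carries mass contains a point within [s0] of the centre of the cell of [x]; the two
   cell radii add 2. The absolute value covers a negative [s0]. *)
have supp j x : Num.sqrt (fine (A (c (p x)) j)) != 0 -> d x (c j) <= `|s0| + 2.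
  move=> Aj; apply: contrapT => /negP; rewrite -ltNge => xj; move/negP: Aj; apply.
  apply/eqP; rewrite (_ : A _ _ = 0%E) ?sqrtr0//.
  rewrite /A (eq_integral (cst 0%E)) ?integral0// => z; rewrite inE /= => pz.
  rewrite phis ?nsq0//.
  have := dtri x (c (p x)) (c j); have := dtri (c (p x)) z (c j).
  have := cp x; have := cp z; rewrite pz; have := ler_norm s0; lra.
exists (fun j x => Num.sqrt (fine (A (c (p x)) j))), (2 * `|s0| + 4); split.
- by rewrite ltr_wpDl// mulr_ge0.
- by move=> j; apply: (measurable_fun_partition mp (fun i => Num.sqrt (fine (A (c i) j)))).
- by move=> j x; rewrite sqrtr_ge0 -[leRHS]sqrtr1 ler_wsqrtr.
- move=> j x y /supp xj /supp yj; have := dtri x (c j) y; rewrite (dC (c j) y); lra.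
split.
  move=> x; under eq_eseriesr do rewrite sqr_sqrtr ?AE//.
  rewrite -(phi1 (c (p x))) /energy (integral_partition mu mp)//.
  by move=> z; rewrite lee_fin nsq_ge0.
move=> x y xy; set i := c (p x); set i' := c (p y).
have ii' : d i i' < r + 2.
  have := dtri i x i'; have := dtri x y i'; have := cp x; have := cp y.
  by rewrite -/i -/i' (dC i x); lra.
(* With squared distance at most [(eta / 2) ^+ 2], the two error terms [(2 * t)^-1 * (eta / 2) ^+ 2]
   and [2 * t] are both [eta / 2]. *)
pose t := eta / 4; have t0 : 0 < t by rewrite divr_gt0.
have u0 : 0 <= (2 * t)^-1 by rewrite invr_ge0 mulr_ge0// ltW.
pose h z := (2 * t)^-1 * nsq (phi i z - phi i' z) + t * (nsq (phi i z) + nsq (phi i' z)).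
have h0 z : 0 <= h z.
  exact: addr_ge0 (mulr_ge0 u0 (nsq_ge0 _)) (mulr_ge0 (ltW t0) (addr_ge0 (nsq_ge0 _) (nsq_ge0 _))).
have [[[mi _] _] [[mi' _] _]] := (phiL i, phiL i').
have mB : cmeas (fun z => phi i z - phi i' z) by exact: cmeasB.
have mh : measurable_fun setT h.
  apply: measurable_funD; first by apply: measurable_funM => //; exact: measurable_nsq.
  by apply: measurable_funM => //; apply: measurable_funD; exact: measurable_nsq.
have Ale u v j : (forall z, nsq (phi u z) <= nsq (phi v z) + h z) ->
    (A u j <= A v j + \int[mu]_(z in p @^-1` [set j]) (h z)%:E)%E.
  move=> uv; rewrite -ge0_integralD//; last 4 first.
  - by move=> z _; rewrite lee_fin nsq_ge0.
  - exact: measurable_funTS.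
  - by move=> z _; rewrite lee_fin.
  - by apply: measurable_funTS; apply/measurable_EFinP; exact: mh.
  apply: ge0_le_integral => //.
  - by move=> z _; rewrite lee_fin nsq_ge0.
  - exact: measurable_funTS.
  - apply: measurable_funTS; apply: emeasurable_funD => //; exact/measurable_EFinP.
  - by move=> z _; rewrite -EFinD lee_fin.
(* Termwise, the squared difference of roots is at most the difference of the masses, and [Ale] in
   both directions bounds that by the integral of [h] over the cell. *)
apply: (@le_trans _ _ (\sum_(j <oo) \int[mu]_(z in p @^-1` [set j]) (h z)%:E)%E).
  apply: lee_nneseries => [j _ _|j _]; first by rewrite lee_fin sqr_ge0.
  have H1 := Ale i i' j (fun z => nsq_le_perturb _ _ t0).
  have H2 : (A i' j <= A i j + \int[mu]_(z in p @^-1` [set j]) (h z)%:E)%E.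
    apply: Ale => z; have := nsq_le_perturb (phi i' z) (phi i z) t0; rewrite /h.
    rewrite (_ : nsq (phi i' z - phi i z) = nsq (phi i z - phi i' z)) 1?[nsq (phi i' z) + _]addrC//.
    by rewrite /nsq !Re_sub !Im_sub; ring.
  apply: (@le_trans _ _ (`|fine (A i j) - fine (A i' j)|)%:E).
    by rewrite lee_fin sqr_sqrtB_le.
  move: H1 H2; rewrite -(AE i j) -(AE i' j).
  have : (0 <= \int[mu]_(z in p @^-1` [set j]) (h z)%:E)%E.
    by apply: integral_ge0 => z _; rewrite lee_fin.
  case: (\int[mu]_(z in p @^-1` [set j]) (h z)%:E)%E => [e| |]//.
    move=> _; rewrite -!EFinD !lee_fin ler_norml => H1 H2; lra.
  by move=> _ _ _; rewrite leey.
rewrite -(integral_partition mu mp)//; last exact/measurable_EFinP.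
have := phiV i i' ii' => /ltW; rewrite norm2_le ?divr_ge0 ?(ltW eta0)// => eB.
rewrite (eq_integral (fun z => (2 * t)^-1%:E * (nsq (phi i z - phi i' z))%:E +
  t%:E * ((nsq (phi i z))%:E + (nsq (phi i' z))%:E))%E)//.
rewrite ge0_integralD//; last 4 first.
- by move=> z _; rewrite -EFinM lee_fin mulr_ge0 ?nsq_ge0.
- by apply/measurable_EFinP/measurable_funM => //; exact: measurable_nsq.
- move=> z _; apply: mule_ge0; first by rewrite lee_fin ltW.
  by apply: adde_ge0; rewrite lee_fin nsq_ge0.
- apply/measurable_EFinP/measurable_funM => //; apply: measurable_funD; exact: measurable_nsq.
rewrite ge0_integralZl_EFin//; last 2 first.
- by move=> z _; rewrite lee_fin nsq_ge0.
- exact/measurable_EFinP/measurable_nsq.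
rewrite ge0_integralZl_EFin//; last 3 first.
- by move=> z _; rewrite -EFinD lee_fin addr_ge0 ?nsq_ge0.
- apply/measurable_EFinP/measurable_funD; exact: measurable_nsq.
- exact: ltW.
rewrite ge0_integralD//; last 2 first.
- by move=> z _; rewrite lee_fin nsq_ge0.
- by move=> z _; rewrite lee_fin nsq_ge0.
rewrite -!/(energy _ _) !phi1.
apply: (@le_trans _ _ ((2 * t)^-1%:E * ((eta / 2) ^+ 2)%:E + t%:E * (1 + 1))%E).
  by rewrite leeD2r// lee_wpmul2l// lee_fin.
rewrite -[leLHS]/(((2 * t)^-1 * (eta / 2) ^+ 2 + t * (1 + 1))%:E) lee_fin /t.
by rewrite (_ : _ + _ = eta)//; field; rewrite gt_eqF.
Qed.

End PartitionOfUnity.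

(** * Localization of controlled operators *)

Section Localization.
Context {dX : measure_display} {X : measurableType dX} {R : realType}.
Variables (mu : {measure set X -> \bar R}) (d : X -> X -> R).
Hypothesis met : is_metric d.
Hypothesis borel : (@measurable _ X) = <<s [set A | dopen d A] >>.
Hypothesis vol : forall r : R, 0 < r ->
  exists2 V : R, 0 < V & forall x, (mu (cball d x r) <= V%:E)%E.
Variables (c : nat -> X) (p : X -> nat).
Hypothesis cp : forall x, d x (c (p x)) < 1.
Hypothesis mp : forall n, measurable (p @^-1` [set n]).

Let dC x y : d x y = d y x. Proof. by case: met. Qed.
Let dtri x y z : d x z <= d x y + d y z. Proof. by case: met. Qed.
Let mball x s : measurable (cball d x s). Proof. exact: measurable_cball. Qed.

(** Cells whose centre lies within [rho] of [y] are disjoint and contained in the ball of radius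
    [rho + 1] around [y]. *)
Lemma sum_cells_le (rho : R) y :
  (\sum_(n <oo) ((\1_(cball d (c n) rho) y)%:E * mu (p @^-1` [set n]))
     <= mu (cball d y (rho + 1)))%E.
Proof.
rewrite -[X in (_ <= mu X)%E]setIT -integral_indic//.
rewrite (integral_partition mu mp)//; last first.
  by apply/measurable_EFinP; exact: measurable_indic.
apply: lee_nneseries => [n _ _|n _]; first by rewrite mule_ge0 ?lee_fin.
rewrite integral_indic// indicE.
have [yn|yn] := pselect (cball d (c n) rho y); last by rewrite memNset// mul0e.
rewrite mem_set// mul1e; apply: le_measure; rewrite ?inE//; first exact: measurableI.
move=> x /= px; split=> //; rewrite /cball /=.
have := cp x; have := dtri y (c n) x; move: yn.
by rewrite px /cball /= (dC (c n) x) (dC y (c n)); lra.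
Qed.

(** A discrete Tonelli argument: the inner integral is constant in [x] on each cell, so only a
    series and an integral are exchanged. The weight then met at [y] is the volume bounded in
    [sum_cells_le]. *)
Lemma integral_overlap_le (rho V : R) (w : X -> R) :
  (forall x, (mu (cball d x (rho + 1)) <= V%:E)%E) ->
  measurable_fun setT w -> (forall y, 0 <= w y) ->
  (\int[mu]_x \int[mu]_y (\1_(cball d (c (p x)) rho) y * w y)%:E
    <= V%:E * \int[mu]_y (w y)%:E)%E.
Proof.
move=> hV mw w0.
have m1 n : measurable_fun setT (fun y => (\1_(cball d (c n) rho) y * w y)%:E).
  by apply/measurable_EFinP/measurable_funM => //; exact: measurable_indic.
have p1 n y : (0 <= (\1_(cball d (c n) rho) y * w y)%:E)%E.
  by rewrite lee_fin mulr_ge0.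
pose G n := (\int[mu]_y (\1_(cball d (c n) rho) y * w y)%:E)%E.
have G0 n : (0 <= G n)%E by exact: integral_ge0.
rewrite -/(G _) (integral_partition mu mp); last 2 first.
- exact: (measurable_fun_partition mp G).
- by move=> x; exact: G0.
rewrite (@eq_eseriesr _ _ (fun n => \int[mu]_y ((\1_(cball d (c n) rho) y * w y)%:E * mu (p @^-1` [set n])))%E); last first.
  move=> n _; rewrite ge0_integralZr// -/(G n).
  rewrite (eq_integral (cst (G n))) ?integral_cst//.
  by move=> x; rewrite inE /= => ->.
rewrite -integral_nneseries//; last 2 first.
- by move=> n; apply: emeasurable_funM => //; exact: measurable_cst.
- by move=> n y _; rewrite mule_ge0.
rewrite -ge0_integralZl//; last 3 first.
- exact/measurable_EFinP.
- by move=> y _; rewrite lee_fin.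
- by apply: le_trans (hV point).
apply: ge0_le_integral => //.
- by move=> y _; apply: nneseries_ge0 => n _ _; rewrite mule_ge0.
- apply: (@ge0_emeasurable_sum _ _ _ _ _ predT) => //.
    by move=> n y _ _; rewrite mule_ge0.
  by move=> n _; apply: emeasurable_funM => //; exact: measurable_cst.
- by apply: measurable_funeM; exact/measurable_EFinP.
- move=> y _; rewrite (@eq_eseriesr _ _ (fun n => (w y)%:E * ((\1_(cball d (c n) rho) y)%:E * mu (p @^-1` [set n])))%E); last first.
    by move=> n _; rewrite muleA -EFinM mulrC.
  rewrite nneseriesZl; last by move=> n _; rewrite mule_ge0 ?lee_fin.
  rewrite [leRHS]muleC lee_wpmul2l ?lee_fin//.
  by apply: le_trans (sum_cells_le _ _) _; exact: hV.
Qed.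

Variables (k : X -> X -> R[i]) (M r : R).
Hypothesis M0 : 0 <= M.
Hypothesis r0 : 0 < r.
Hypothesis kM : forall x y, cabs (k x y) <= M.
Hypothesis kr : forall x y, r < d x y -> k x y = 0.
Hypothesis kc : forall e : R, 0 < e -> exists2 delta : R, 0 < delta &
  forall x y x' y', d x x' < delta -> d y y' < delta -> cabs (k x y - k x' y') < e.

Let commutator (g : X -> R) (f : X -> R[i]) x : R[i] :=
  Complex (g x) 0 * Op mu k f x - Op mu k (fun y => Complex (g y) 0 * f y) x.

(** At fixed [x] the commutator bounds are summed over [j] under the integral in [y], where the
    variation of the [psi j] is at most [eta] on the ball involved. Integrating in [x] then costs
    only the overlap bound [V2]. *)
Lemma sum_energy_commutator_le (psi : nat -> X -> R) (eta V1 V2 : R) f :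
  (forall j, measurable_fun setT (psi j)) -> (forall j x, 0 <= psi j x <= 1) ->
  (forall x y, d x y < r + 3 ->
    (\sum_(j <oo) ((psi j x - psi j y) ^+ 2)%:E <= eta%:E)%E) ->
  0 <= eta -> 0 < V1 ->
  (forall x, (mu (cball d x (r + 1)) <= V1%:E)%E) ->
  (forall x, (mu (cball d x (r + 1 + 1)) <= V2%:E)%E) ->
  inL2 mu f ->
  (\sum_(j <oo) energy mu (commutator (psi j) f)
     <= (2 * V1 * M ^+ 2 * eta)%:E * (V2%:E * energy mu f))%E.
Proof.
move=> mpsi psi01 psieta eta0 V10 hV1 hV2 fL.
have [mf fe] := (inL2P mu f).1 fL.
have psi1 j x : `|psi j x| <= 1 by case/andP: (psi01 j x) => ? ?; rewrite ger0_norm.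
have psifL j : inL2 mu (fun y => Complex (psi j y) 0 * f y).
  apply: (le_inL2 fL); first exact: cmeasZ.
  by move=> y; rewrite nsqZ ler_piMl ?nsq_ge0// -real_normK ?num_real// expr_le1.
have mcomm j : cmeas (commutator (psi j) f).
  apply: cmeasB; last exact: (cmeas_Op met borel vol M0 r0 kM kr kc).
  by apply: cmeasZ => //; exact: (cmeas_Op met borel vol M0 r0 kM kr kc).
set C := 2 * V1 * M ^+ 2.
have C0 : 0 <= C by rewrite /C !mulr_ge0// ?ltW// exprn_ge0.
rewrite -integral_nneseries//; last 2 first.
- by move=> j; apply/measurable_EFinP/measurable_nsq.
- by move=> j x _; rewrite lee_fin nsq_ge0.
have mG n : measurable_fun setT (fun y => (\1_(cball d (c n) (r + 1)) y * nsq (f y))%:E).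
  apply/measurable_EFinP/measurable_funM; last exact: measurable_nsq.
  exact: measurable_indic.
pose G n := (\int[mu]_y (\1_(cball d (c n) (r + 1)) y * nsq (f y))%:E)%E.
have G0 n : (0 <= G n)%E.
  by apply: integral_ge0 => y _; rewrite lee_fin mulr_ge0 ?nsq_ge0.
have mGp : measurable_fun setT (fun x => G (p x)).
  exact: (measurable_fun_partition mp G).
apply: (@le_trans _ _ ((C * eta)%:E * \int[mu]_x G (p x))%E); last first.
  rewrite lee_wpmul2l ?lee_fin ?(mulr_ge0 C0 eta0)//.
  apply: integral_overlap_le => //; first exact: measurable_nsq.
  by move=> y; exact: nsq_ge0.
rewrite -ge0_integralZl_EFin ?(mulr_ge0 C0 eta0)//.
apply: ge0_le_integral => //.
- by move=> x _; apply: nneseries_ge0 => j _ _; rewrite lee_fin nsq_ge0.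
- apply: (@ge0_emeasurable_sum _ _ _ _ _ predT) => //.
    by move=> j x _ _; rewrite lee_fin nsq_ge0.
  by move=> j _; apply/measurable_EFinP/measurable_nsq.
- exact: measurable_funeM.
move=> x _.
set D := cball d (c (p x)) (r + 1); have mD : measurable D by exact: mball.
pose h j y := \1_D y * (psi j x - psi j y) ^+ 2 * nsq (f y).
have h0 j y : 0 <= h j y by rewrite mulr_ge0 ?nsq_ge0// mulr_ge0 ?sqr_ge0.
have mh j : measurable_fun setT (h j).
  apply: measurable_funM; last exact: measurable_nsq.
  apply: measurable_funM; first exact: measurable_indic.
  by apply: measurable_funX; apply: measurable_funB.
have hfin j : (\int[mu]_y (h j y)%:E < +oo)%E.
  apply: le_lt_trans fe; apply: ge0_le_integral => //.
  - by move=> y _; rewrite lee_fin.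
  - exact/measurable_EFinP.
  - exact/measurable_EFinP/measurable_nsq.
  - move=> y _; rewrite lee_fin /h -mulrA.
    have : (psi j x - psi j y) ^+ 2 <= 1.
      rewrite -real_normK ?num_real// expr_le1// ler_norml.
      by case/andP: (psi01 j x) => ? ?; case/andP: (psi01 j y) => ? ?; apply/andP; split; lra.
    have := nsq_ge0 (f y); rewrite indicE; case: (_ \in _) => /=; last by rewrite mul0r.
    by rewrite mul1r => n0 ?; rewrite ler_piMl.
have hE j : (fine (\int[mu]_y (h j y)%:E))%:E = (\int[mu]_y (h j y)%:E)%E.
  by rewrite fineK// ge0_fin_numE// integral_ge0// => y _; rewrite lee_fin.
apply: (@le_trans _ _ (\sum_(j <oo) C%:E * \int[mu]_y (h j y)%:E)%E).
  apply: lee_nneseries => [j _ _|j _]; first by rewrite lee_fin nsq_ge0.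
  rewrite -hE -EFinM lee_fin /C -(mulrA (2 * V1)) -(mulrA 2).
  apply: (nsq_commutator_le met borel vol M0 r0 kM kr kc (mpsi j) (psi1 j) fL (ltW (cp x)) V10 (hV1 _)).
  by rewrite hE.
rewrite nneseriesZl; last by move=> j _; apply: integral_ge0 => y _; rewrite lee_fin.
rewrite (EFinM C eta) -muleA lee_wpmul2l// -integral_nneseries//; last 2 first.
- by move=> j; exact/measurable_EFinP.
- by move=> j y _; rewrite lee_fin.
rewrite -ge0_integralZl_EFin//; last first.
  by move=> y _; rewrite lee_fin mulr_ge0 ?nsq_ge0.
apply: ge0_le_integral => //.
- by move=> y _; apply: nneseries_ge0 => j _ _; rewrite lee_fin.
- apply: (@ge0_emeasurable_sum _ _ _ _ _ predT) => //.
    by move=> j y _ _; rewrite lee_fin.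
  by move=> j _; exact/measurable_EFinP.
- exact: measurable_funeM.
move=> y _; rewrite /h.
rewrite (@eq_eseriesr _ _ (fun j => (\1_D y * nsq (f y))%:E * ((psi j x - psi j y) ^+ 2)%:E)%E); last first.
  by move=> j _; rewrite -EFinM mulrAC.
rewrite nneseriesZl; last by move=> j _; rewrite lee_fin sqr_ge0.
rewrite [leRHS]muleC.
have [yD|yD] := pselect (D y); last by rewrite indicE memNset// mul0r !mul0e.
rewrite lee_wpmul2l ?lee_fin ?mulr_ge0 ?nsq_ge0//; apply: psieta.
by move: yD; rewrite /D /cball /=; have := cp x; have := dtri x (c (p x)) y; lra.
Qed.

(* If [psi j] does not vanish on [F], then [psi j * f] is supported in a ball around
   a point of [F], where the norm of the operator is controlled by hypothesis; the
   commutators with the [psi j] are controlled by the variation of the [psi j]. *)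
Lemma localization (eta : R) : propertyA mu d -> 0 < eta ->
  exists2 s : R, 0 < s & forall (F : set X) (a : R), measurable F -> 0 <= a ->
    (forall x f, F x -> inL2 mu f -> (forall y, s < d x y -> f y = 0) ->
       (energy mu (Op mu k f) <= a%:E * energy mu f)%E) ->
    forall f, inL2 mu f ->
      (energy mu (mulind F (Op mu k f)) <= (2 * a + eta)%:E * energy mu f)%E.
Proof.
move=> pA eta0.
have [V1 V10 hV1] := vol (addr_gt0 r0 ltr01).
have [V2 V20 hV2] := vol (addr_gt0 (addr_gt0 r0 ltr01) ltr01).
(* Twice the constant of [sum_energy_commutator_le], the factor 2 coming from [energyD_le]. A
   variation of [eta / (K + 1)] makes the commutators contribute at most [eta]. *)
pose K := 2 * (2 * V1 * M ^+ 2) * V2.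
have K0 : 0 <= K by rewrite /K !mulr_ge0// ?ltW// exprn_ge0.
have K1 : 0 < K + 1 by rewrite ltr_wpDl.
have eta'0 : 0 < eta / (K + 1) by rewrite divr_gt0.
have r30 : 0 < r + 3 by rewrite addr_gt0.
have [psi [s [s0 mpsi psi01 psis [psi1 psieta]]]] := partition_of_unity met cp mp pA eta'0 r30.
exists s => // F a mF a0 Fa f fL; have [mf fe] := (inL2P mu f).1 fL.
have psifL j : inL2 mu (fun y => Complex (psi j y) 0 * f y).
  apply: (le_inL2 fL); first exact: cmeasZ.
  move=> y; rewrite nsqZ ler_piMl ?nsq_ge0// expr_le1//; first by case/andP: (psi01 j y).
  by case/andP: (psi01 j y).
have mS g : inL2 mu g -> cmeas (Op mu k g).
  exact: (cmeas_Op met borel vol M0 r0 kM kr kc).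
have mcomm j : cmeas (commutator (psi j) f).
  by apply: cmeasB; [apply: cmeasZ => //; exact: mS|exact: mS].
have split_energy g : cmeas g ->
    (energy mu g = \sum_(j <oo) energy mu (fun x => Complex (psi j x) 0 * g x)%R)%E.
  move=> mg; rewrite /energy -integral_nneseries//; last 2 first.
  - by move=> j; apply/measurable_EFinP/measurable_nsq; exact: cmeasZ.
  - by move=> j x _; rewrite lee_fin nsq_ge0.
  apply: eq_integral => x _.
  under eq_eseriesr do rewrite nsqZ mulrC EFinM.
  by rewrite nneseriesZl ?psi1 ?mule1// => j _; rewrite lee_fin sqr_ge0.
rewrite split_energy; last by apply: cmeas_mulind => //; exact: mS.
have step j : (energy mu (fun x => Complex (psi j x) 0 * mulind F (Op mu k f) x)%R
    <= (2 * a)%:E * energy mu (fun y => Complex (psi j y) 0 * f y)%R +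
       2%:E * energy mu (commutator (psi j) f))%E.
  (* If [psi j] vanishes on [F], the left side is zero. Otherwise [psi j * S f] is [S (psi j * f)]
     plus the commutator, and the first term is local around a point of [F]. *)
  have [[x [Fx psix]]|noF] := pselect (exists x, F x /\ psi j x != 0); last first.
    rewrite {1}/energy (eq_integral (cst 0%E)) ?integral0.
      by rewrite adde_ge0// mule_ge0 ?energy_ge0// lee_fin mulr_ge0.
    move=> x _; rewrite nsqZ /mulind; case: asboolP => Fx; last by rewrite nsq0 mulr0.
    have -> : psi j x = 0.
      by apply/eqP; apply: contrapT => /negP psix; apply: noF; exists x.
    by rewrite expr0n mul0r.
  apply: le_trans (_ : 2%:E * energy mu (Op mu k (fun y => Complex (psi j y) 0 * f y)%R) +
       2%:E * energy mu (commutator (psi j) f) <= _)%E.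
    apply: energyD_le => //.
    - exact: mS.
    - by apply: cmeasZ => //; apply: cmeas_mulind => //; exact: mS.
    - move=> z; apply: le_trans (nsqD_le _ _).
      by rewrite addrC subrK !nsqZ ler_wpM2l ?sqr_ge0// nsq_mulind_le.
  rewrite leeD2r// EFinM -muleA lee_pmul2l//; apply: (Fa x) => // y xy.
  have [->|psiy] := eqVneq (psi j y) 0; first by rewrite mul0r.
  by have := psis j x y psix psiy; rewrite leNgt xy.
apply: (@le_trans _ _ (\sum_(j <oo) ((2 * a)%:E * energy mu (fun y => Complex (psi j y) 0 * f y)%R +
       2%:E * energy mu (commutator (psi j) f)))%E).
  by apply: lee_nneseries => // j _ _; exact: energy_ge0.
rewrite nneseriesD; last 2 first.
- by move=> j _ _; rewrite mule_ge0 ?energy_ge0// lee_fin mulr_ge0.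
- by move=> j _ _; rewrite mule_ge0 ?energy_ge0.
rewrite !nneseriesZl; last 2 first.
- by move=> j _; exact: energy_ge0.
- by move=> j _; exact: energy_ge0.
rewrite -split_energy// [in leRHS](EFinD (2 * a)) ge0_muleDl ?lee_fin ?mulr_ge0// ?(ltW eta0)//.
rewrite leeD2l//.
apply: (@le_trans _ _ (2%:E * ((2 * V1 * M ^+ 2 * (eta / (K + 1)))%:E * (V2%:E * energy mu f)))%E).
  by rewrite lee_pmul2l//; apply: sum_energy_commutator_le => //; exact: ltW.
rewrite !muleA -!EFinM lee_wpmul2r ?energy_ge0// lee_fin.
rewrite (_ : _ * V2 = eta * (K / (K + 1))); last by rewrite /K; field; rewrite gt_eqF.
by rewrite ler_piMr ?ltW// ltr_pdivrMr// mul1r ltrDl.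
Qed.

End Localization.

(** * Bounded operators and the ideals *)

Section BoundedOperators.
Context {dX : measure_display} {X : measurableType dX} {R : realType}.
Variables (mu : {measure set X -> \bar R}).
Variable T : (X -> R[i]) -> (X -> R[i]).
Hypothesis bT : bounded_op mu T.
Implicit Types (A B : set X) (f : X -> R[i]).

Lemma cmeas_op f : inL2 mu f -> cmeas (T f).
Proof. by case: bT => h _ _ _ /h[]. Qed.

(** Linearity is given for [a * f + g], so [T 0 = 0] almost everywhere is first extracted from the
    case [a = 1], [f = g = 0]. *)
Lemma bounded_opZ (t : R) f : inL2 mu f ->
  {ae mu, forall x, T (fun y => Complex t 0 * f y) x = Complex t 0 * T f x}.
Proof.
case: bT => _ _ lin _ fL.
have zL : inL2 mu (fun=> 0 : R[i]).
  apply/inL2P; split; first by split=> /=; exact: measurable_cst.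
  by rewrite /energy; under eq_integral do rewrite nsq0; rewrite integral0.
have h0 := lin 1 _ _ zL zL; have ht := lin (Complex t 0) _ _ fL zL.
move: h0 ht.
rewrite (_ : (fun y : X => 1 * 0 + 0) = (fun=> 0 : R[i])); last first.
  by apply/funext => y; rewrite mulr0 addr0.
rewrite (_ : (fun y : X => Complex t 0 * f y + 0) = (fun y => Complex t 0 * f y)); last first.
  by apply/funext => y; rewrite addr0.
apply: filterS2 => x /esym/eqP; rewrite mul1r -subr_eq0 addrK => /eqP z0 ->.
by rewrite z0 addr0.
Qed.

Lemma mulindK B f : (forall y, ~ B y -> f y = 0) -> mulind B f = f.
Proof. by move=> fB; apply/funext => y; rewrite /mulind; case: asboolP => // /fB ->. Qed.

Lemma mulindS A B f : A `<=` B -> mulind B (mulind A f) = mulind A f.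
Proof.
move=> AB; apply: mulindK => y nBy; rewrite /mulind.
by case: asboolP => // /AB.
Qed.

(** Truncation to [A] keeps a test function in the unit ball, and the cut-off by [B] then leaves it
    unchanged, so every value on the left occurs on the right. *)
Lemma opnorm_mulindr_le A B : measurable A -> A `<=` B ->
  (opnorm mu (fun f => T (mulind A f)) <= opnorm mu (fun f => T (mulind B f)))%E.
Proof.
move=> mA AB; apply: ge_ereal_sup => _ [f [fL f1] <-]; rewrite -(mulindS _ AB).
apply: ereal_sup_ubound; exists (mulind A f) => //; split; first exact: inL2_mulind.
move: f1; rewrite !norm2_le//; apply: le_trans.
apply: le_energy; last by move=> x; exact: nsq_mulind_le.
  by apply: cmeas_mulind => //; case: fL.
by case: fL.
Qed.

Lemma energy_op_supported (e : R) B f : measurable B -> 0 <= e ->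
  (opnorm mu (fun f => T (mulind B f)) <= e%:E)%E -> inL2 mu f ->
  (forall y, ~ B y -> f y = 0) -> (energy mu (T f) <= (e ^+ 2)%:E * energy mu f)%E.
Proof.
move=> mB e0 Te fL fB.
have := @opnorm_energy _ _ _ mu (fun f => T (mulind B f)) e e0 Te.
move=> /(_ _ _ f fL); rewrite mulindK//; apply.
- by move=> g gL; apply: cmeas_op; exact: inL2_mulind.
- move=> t g _ gL.
  rewrite (_ : mulind B _ = (fun y => Complex t 0 * mulind B g y)).
    by apply: bounded_opZ; exact: inL2_mulind.
  by apply/funext => y; rewrite /mulind; case: ifP => // _; rewrite mulr0.
Qed.

End BoundedOperators.

(** * The three implications *)

Section ClassA.
Context {dX : measure_display} {X : measurableType dX} {R : realType}.
Variables (mu : {measure set X -> \bar R}) (d : X -> X -> R).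
Hypothesis met : is_metric d.
Hypothesis borel : (@measurable _ X) = <<s [set A | dopen d A] >>.
Hypothesis vol : forall r : R, 0 < r ->
  exists2 V : R, 0 < V & forall x, (mu (cball d x r) <= V%:E)%E.
Variable xi : set_system X.
Hypothesis Fxi : ProperFilter xi.
Variable T : (X -> R[i]) -> (X -> R[i]).
Hypothesis ET : in_Eop mu d T.

Let dC x y : d x y = d y x. Proof. by case: met. Qed.
Let dtri x y z : d x z <= d x y + d y z. Proof. by case: met. Qed.
Let mball x s : measurable (cball d x s). Proof. exact: measurable_cball. Qed.
Let mT f : inL2 mu f -> cmeas (T f). Proof. by case: ET => bT _; exact: cmeas_op. Qed.

Lemma Eop_approx (e : R) : 0 < e -> exists (k : X -> X -> R[i]) (M r : R),
  [/\ 0 <= M, 0 < r, forall x y, cabs (k x y) <= M,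
    forall x y, r < d x y -> k x y = 0 &
    (forall e : R, 0 < e -> exists2 delta : R, 0 < delta &
      forall x y x' y', d x x' < delta -> d y y' < delta -> cabs (k x y - k x' y') < e) /\
    (forall f, inL2 mu f -> cmeas (Op mu k f) /\
      (energy mu (fun x => T f x - Op mu k f x)%R <= (e ^+ 2)%:E * energy mu f)%E)].
Proof.
move=> e0; case: ET => bT /(_ e e0)[k [[[M kM] kc [r kr]] ke]].
have M0 : 0 <= M := le_trans (cabs_ge0 _) (kM point point).
(* The range of the kernel may be given by a nonpositive number, so it is enlarged to a positive
   one. *)
have r0 : 0 < `|r| + 1 by have := normr_ge0 r; lra.
have kr' x y : `|r| + 1 < d x y -> k x y = 0.
  by move=> xy; apply: kr; have := ler_norm r; lra.
exists k, M, (`|r| + 1); split=> //; split=> // f fL.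
have mS g : inL2 mu g -> cmeas (Op mu k g).
  exact: (cmeas_Op met borel vol M0 r0 kM kr' kc).
split; first exact: mS.
apply: (@opnorm_energy _ _ _ mu (fun f x => T f x - Op mu k f x) e (ltW e0) (ltW ke)) => //.
- by move=> g gL; apply: cmeasB; [exact: mT|exact: mS].
- move=> t g _ gL; apply: filterS (bounded_opZ bT t gL) => x ->.
  by rewrite (OpZ met borel vol M0 r0 kM kr' kc)// mulrBr.
Qed.

Lemma cball_sub_Finner F r x : Finner d F r x -> cball d x r `<=` F.
Proof.
rewrite /Finner /= => h y xy; apply: contrapT => nFy; move: h; apply/negP.
rewrite -leNgt; apply: (@le_trans _ _ (d x y)%:E); last by rewrite lee_fin.
by apply: ereal_inf_lbound; exists y.
Qed.

Lemma Jop_lim_left : in_Jop mu d (cofilt d xi) T -> forall r : R, 0 < r ->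
  lim0 xi (fun x => opnorm mu (fun f => mulind (cball d x r) (T f))).
Proof.
move=> [_ J0] r r0 e e0.
(* Halving [e] makes up for [opnorm_leP] giving only weak inequalities. *)
have : (ereal_inf [set opnorm mu (fun f => mulind F (T f)) |
  F in [set F | measurable F /\ cofilt d xi F]] < (e / 2)%:E)%E.
  by rewrite J0 lte_fin divr_gt0.
move=> /ereal_inf_lt[_ [F [mF /(_ r r0) coF] <-]] /ltW.
rewrite opnorm_leP ?divr_ge0 ?(ltW e0)// => Fe.
apply: filterS coF => x /cball_sub_Finner xF /=.
rewrite gee0_abs ?opnorm_ge0//.
apply: (@le_lt_trans _ _ (e / 2)%:E); last by rewrite lte_fin; lra.
rewrite opnorm_leP ?divr_ge0 ?(ltW e0)// => f fL f1; apply: le_trans (Fe f fL f1).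
apply: le_energy.
- by apply: cmeas_mulind => //; exact: mT.
- by apply: cmeas_mulind => //; exact: mT.
- move=> y; rewrite {1}/mulind; case: asboolP => [/xF Fy|_]; last by rewrite nsq0 nsq_ge0.
  by rewrite /mulind; case: asboolP.
Qed.

Lemma lim_left_right :
  (forall r : R, 0 < r ->
    lim0 xi (fun x => opnorm mu (fun f => mulind (cball d x r) (T f)))) ->
  forall r : R, 0 < r ->
    lim0 xi (fun x => opnorm mu (fun f => T (mulind (cball d x r) f))).
Proof.
move=> h r r0 e e0; have e10 : 0 < e / 8 by rewrite divr_gt0.
have [k [M [rk [M0 rk0 kM kr [kc kT]]]]] := Eop_approx e10.
apply: filterS (h (r + rk) (addr_gt0 r0 rk0) (e / 8) e10) => x /=.
rewrite !gee0_abs ?opnorm_ge0// => /ltW; rewrite opnorm_leP ?(ltW e10)// => xe.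
apply: (@le_lt_trans _ _ (e / 2)%:E); last by rewrite lte_fin; lra.
rewrite opnorm_leP ?divr_ge0 ?(ltW e0)// => g gL g1.
set f := mulind _ g.
have fL : inL2 mu f by exact: inL2_mulind.
have f1 : (energy mu f <= 1)%E.
  apply: le_trans g1; apply: le_energy; [by case: fL|by case: gL|].
  by move=> y; exact: nsq_mulind_le.
have [mS Sf] := kT f fL.
have Tf1 : (energy mu (fun x => T f x - Op mu k f x)%R <= ((e / 8) ^+ 2)%:E)%E.
  by apply: le_trans Sf _; rewrite -[leRHS]mule1 lee_wpmul2l// lee_fin sqr_ge0.
have Tf2 := xe f fL f1.
have mTS : cmeas (fun x => T f x - Op mu k f x) by apply: cmeasB => //; exact: mT.
(* The function [Op mu k f] lives on the larger ball, so there it is a truncation of [T f] up to the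
   approximation error. *)
have SB : mulind (cball d x (r + rk)) (Op mu k f) = Op mu k f.
  apply: mulindK => y /negP; rewrite -ltNge; apply: (Op_support mu met kr) => z xz.
  by rewrite /f /mulind; case: asboolP => //; rewrite /cball /= leNgt xz.
have S1 : (energy mu (Op mu k f) <=
    2%:E * energy mu (mulind (cball d x (r + rk)) (T f)) +
    2%:E * energy mu (fun x => T f x - Op mu k f x)%R)%E.
  apply: energyD_le => //; first by apply: cmeas_mulind => //; exact: mT.
  move=> y; rewrite -{1}SB /mulind; case: asboolP => _; last first.
    by rewrite nsq0 addr_ge0// mulr_ge0 ?nsq_ge0.
  by apply: le_trans (nsqB_le _ _); rewrite opprB addrC subrK.
have T1 : (energy mu (T f) <= 2%:E * energy mu (fun x => T f x - Op mu k f x)%R +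
    2%:E * energy mu (Op mu k f))%E.
  apply: energyD_le => //; first exact: mT.
  by move=> y; apply: le_trans (nsqD_le _ _); rewrite subrK.
apply: le_trans T1 _.
(* With [q = (e / 8) ^+ 2], the second energy is at most [2 * q + 2 * q]; rounding it up to [7 * q]
   makes the total [16 * q], exactly [(e / 2) ^+ 2]. *)
apply: (@le_trans _ _ (2%:E * ((e / 8) ^+ 2)%:E + 2%:E * (7 * (e / 8) ^+ 2)%:E)%E); last first.
  by rewrite -!EFinM -EFinD lee_fin; have := sqr_ge0 e; lra.
rewrite leeD ?lee_pmul2l//.
apply: le_trans S1 _.
apply: (@le_trans _ _ (2%:E * ((e / 8) ^+ 2)%:E + 2%:E * ((e / 8) ^+ 2)%:E)%E).
  by rewrite leeD ?lee_pmul2l.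
by rewrite -!EFinM -EFinD lee_fin; have := sqr_ge0 (e / 8); lra.
Qed.

Lemma lim_right_Jop (c : nat -> X) (p : X -> nat) :
  (forall x, d x (c (p x)) < 1) -> (forall n, measurable (p @^-1` [set n])) ->
  propertyA mu d ->
  (forall r : R, 0 < r ->
    lim0 xi (fun x => opnorm mu (fun f => T (mulind (cball d x r) f)))) ->
  in_Jop mu d (cofilt d xi) T.
Proof.
move=> cp mp pA h; split=> //; have [bT _] := ET.
apply/eqP; rewrite eq_le; apply/andP; split; last first.
  by apply: le_ereal_inf_tmp => _ [F _ <-]; exact: opnorm_ge0.
apply/lee_addgt0Pr => e e0; rewrite add0e.
have e10 : 0 < e / 8 by rewrite divr_gt0.
have [k [M [rk [M0 rk0 kM kr [kc kT]]]]] := Eop_approx e10.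
have q0 : 0 < (e / 8) ^+ 2 by rewrite exprn_gt0.
have [s s0 loc] := localization met borel vol cp mp M0 rk0 kM kr kc pA q0.
have s10 : 0 < s + 1 by rewrite addr_gt0.
(* The set [F0] need not be open, so its open unit neighbourhood [F] is used. The radius [s + 1]
   compensates: a ball of radius [s] around a point of [F] lies in a ball of radius [s + 1] around a
   point of [F0]. *)
pose F0 := [set x | opnorm mu (fun f => T (mulind (cball d x (s + 1)) f)) < (e / 8)%:E]%E.
pose F := \bigcup_(x in F0) [set y | d x y < 1].
have F0F : F0 `<=` F.
  by move=> x F0x; exists x => //=; case: met => _ dxx _ _; rewrite (dxx x x).2.
have mF : measurable F.
  by apply: (dopen_measurable borel); apply: dopen_bigcup => x _; exact: dopen_oball.
have coF : cofilt d xi F.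
  move=> r r0.
  (* Any [y] within [2 * r] of [x] has its ball of radius [s + 1] inside the ball around [x], so it
     lies in [F0]. The complement of [F] is thus at distance at least [2 * r], strictly more than
     [r]. *)
  have r20 : 0 < s + 1 + 2 * r by rewrite addr_gt0// mulr_gt0.
  apply: filterS (h _ r20 _ e10) => x /=; rewrite gee0_abs ?opnorm_ge0// => xe.
  rewrite /Finner /=; apply: (@lt_le_trans _ _ (2 * r)%:E); first by rewrite lte_fin; lra.
  apply: le_ereal_inf_tmp => _ [y nFy <-]; rewrite lee_fin leNgt; apply/negP => xy.
  apply: nFy; apply: F0F; apply: le_lt_trans xe.
  apply: opnorm_mulindr_le => // z; rewrite /cball /= => yz.
  by have := dtri x y z; lra.
apply: (@le_trans _ _ (opnorm mu (fun f => mulind F (T f)))).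
  by apply: ereal_inf_lbound; exists F.
rewrite opnorm_leP ?(ltW e0)// => f fL f1; have [mS Sf] := kT f fL.
have locF x g : F x -> inL2 mu g -> (forall y, s < d x y -> g y = 0) ->
    (energy mu (Op mu k g) <= (4 * (e / 8) ^+ 2)%:E * energy mu g)%E.
  move=> [x0 F0x0 /= x0x] gL gs; have [mSg Sg] := kT g gL.
  have Tg : (energy mu (T g) <= ((e / 8) ^+ 2)%:E * energy mu g)%E.
    apply: (energy_op_supported bT (mball x0 (s + 1))) => //.
    - exact: ltW.
    - exact: ltW.
    - move=> y /negP; rewrite -ltNge => x0y; apply: gs.
      by have := dtri x0 x y; lra.
  apply: le_trans (_ : 2%:E * energy mu (T g) +
      2%:E * energy mu (fun x => T g x - Op mu k g x)%R <= _)%E.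
    apply: energyD_le => //; [exact: mT|by apply: cmeasB => //; exact: mT|].
    by move=> y; apply: le_trans (nsqB_le _ _); rewrite opprB addrC subrK.
  apply: (@le_trans _ _ (2%:E * (((e / 8) ^+ 2)%:E * energy mu g) +
      2%:E * (((e / 8) ^+ 2)%:E * energy mu g))%E).
    by rewrite leeD ?lee_pmul2l.
  have q1 : 0 <= 2 * (e / 8) ^+ 2 by rewrite mulr_ge0 ?sqr_ge0.
  rewrite !muleA -!EFinM -ge0_muleDl ?lee_fin// -EFinD.
  by rewrite (_ : _ + _ = 4 * (e / 8) ^+ 2)//; ring.
have q4 : 0 <= 4 * (e / 8) ^+ 2 by rewrite mulr_ge0 ?sqr_ge0.
have LF := loc F _ mF q4 locF f fL.
have bnd (a : R) : 0 <= a -> (a%:E * energy mu f <= a%:E)%E.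
  by move=> a0; rewrite -[leRHS]mule1 lee_wpmul2l.
apply: le_trans (_ : 2%:E * energy mu (fun x => T f x - Op mu k f x)%R +
    2%:E * energy mu (mulind F (Op mu k f)) <= _)%E.
  apply: energyD_le => //.
  - by apply: cmeasB => //; exact: mT.
  - exact: cmeas_mulind.
  - by apply: cmeas_mulind => //; exact: mT.
  move=> y; rewrite /mulind; case: asboolP => _; last first.
    by rewrite nsq0 addr_ge0// mulr_ge0 ?nsq_ge0.
  by apply: le_trans (nsqD_le _ _); rewrite subrK.
(* With [q = (e / 8) ^+ 2], [locF] has constant [4 * q], so [localization] gives
   [2 * (4 * q) + q = 9 * q]. The total [20 * q] is below [e ^+ 2]. *)
apply: (@le_trans _ _ (2%:E * ((e / 8) ^+ 2)%:E + 2%:E * (9 * (e / 8) ^+ 2)%:E)%E).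
  rewrite leeD ?lee_pmul2l//.
    by apply: le_trans Sf _; rewrite bnd ?sqr_ge0.
  apply: le_trans LF _; rewrite (_ : _ + _ = 9 * (e / 8) ^+ 2); last by ring.
  by rewrite bnd// mulr_ge0 ?sqr_ge0.
by rewrite -!EFinM -EFinD lee_fin; have := sqr_ge0 e; lra.
Qed.

End ClassA.

Theorem theorem5p9 (dX : measure_display) (X : measurableType dX) (R : realType)
  (d : X -> X -> R) (mu : {measure set X -> \bar R}) (xi : set_system X)
  (T : (X -> R[i]) -> (X -> R[i])) :
  classA mu d ->
  ProperFilter xi ->
  finer_than_frechet d xi ->
  in_Eop mu d T ->
  (in_Jop mu d (cofilt d xi) T <->
     (forall r : R, 0 < r ->
        lim0 xi (fun x => opnorm mu (fun f => T (mulind (cball d x r) f))))) /\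
  (in_Jop mu d (cofilt d xi) T <->
     (forall r : R, 0 < r ->
        lim0 xi (fun x => opnorm mu (fun f => mulind (cball d x r) (T f))))).
Proof.
move=> [[met prop _ borel _] [_ ball _ pA]] Fxi _ ET.
have vol (r : R) : 0 < r ->
    exists2 V : R, 0 < V & forall x, (mu (cball d x r) <= V%:E)%E.
  move=> r0; have [_] := ball r r0.
  have le_sup x : (mu (cball d x r) <= ereal_sup [set mu (cball d x r) | x in setT])%E.
    by apply: ereal_sup_ubound; exists x.
  case: (ereal_sup _) le_sup => [V| |] le_sup // _.
    exists (`|V| + 1) => [|x]; first by have := normr_ge0 V; lra.
    apply: le_trans (le_sup x) _; rewrite lee_fin.
    by have := ler_norm V; lra.
  by exists 1 => // x; apply: le_trans (le_sup x) _; rewrite leNye.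
have [c [p [cp mp]]] := net_partition met borel point prop.
have J3 := Jop_lim_left met borel Fxi ET.
have J2 := lim_left_right met borel vol Fxi ET.
have J1 := lim_right_Jop met borel vol Fxi ET cp mp pA.
(* The implications form the cycle (i) => (iii) => (ii) => (i). *)
by split; split; [move/J3; exact: J2|exact: J1|exact: J3|move/J2; exact: J1].
Qed.
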